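(* Every COM of rank $2$ has a corner peeling.
   Context: Hypercube $Q_n$: vertex set $\{+,-\}^n$, adjacency = differing in one coordinate; $-v$ is $v$ with all coordinates flipped. A partial cube is an isometric subgraph $G$ of $Q_n$ with $n$ minimal; its edges split into $\Theta$-classes. Convex subgraph: contains all shortest paths between its vertices; gated: every vertex $x$ has a vertex $x'$ of the subgraph on a shortest path from $x$ to each of its vertices. Antipodal: $v\in G\Rightarrow -v\in G$; antipodal subgraph: convex subgraph that is an antipodal partial cube. Rank: largest $r$ with $Q_r$ obtained by successively contracting all edges of $\Theta$-classes. A COM is a partial cube all of whose antipodal subgraphs are gated; an OM is an antipodal COM. Expansion of a partial cube $H$: a partial cube $G'$ with a $\Theta$-class $E$ whose contraction gives $H$, described by the images $H_1,H_2$ of the halfspaces $E^+,E^-$. For OMs $H,G'$ it is in general position if every maximal proper antipodal subgraph of $H$ lies in $H_1$ or $H_2$ but not in $H_1\cap H_2$; then $H\setminus H_1$ is a corner of $H$. A vertex set $C$ of a COM $G$ is a corner if it is contained in a unique maximal antipodal subgraph $H$ of $G$ (no other maximal antipodal subgraph meets $C$) and is a corner of the OM $H$. A corner peeling of $G$ is an ordered partition $C_1,\dots,C_k$ of $V(G)$ such that each $C_i$ is a corner of the subgraph induced by $V(G)\setminus(C_1\cup\dots\cup C_{i-1})$.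
   Formalization: By convention, every single vertex of an OM of rank at most 1 (a vertex or an edge) also counts as a corner; under the literal expansion definition such OMs have no nonempty corner, so no corner peeling could end. *)

(* Defs.v *)
(* Sign vectors {+,-}^n are encoded as {ffun 'I_n -> bool}
   (true = +, false = -). A (sub)graph of Q_n is given by its vertex set;
   it is the induced subgraph of Q_n on that set. *)
From mathcomp Require Import all_boot all_order.
Set Implicit Arguments. Unset Strict Implicit. Unset Printing Implicit Defensive.

Notation sv n := {ffun 'I_n -> bool}.

Definition hamming n (u v : sv n) : nat := #|[set i | u i != v i]|.

Definition qadj n (u v : sv n) : bool := hamming u v == 1.

Definition walk n (V : {set sv n}) (u w : sv n) (p : seq (sv n)) : Prop :=
  [/\ path (@qadj n) u p, last u p = w & all (fun x => x \in V) (u :: p)].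

Definition geodesic n (V : {set sv n}) (u w : sv n) (p : seq (sv n)) : Prop :=
  walk V u w p /\ size p = hamming u w.

(* isometric subgraph of Q_n: graph distance in V equals Hamming distance
   (a walk always has length >= Hamming distance) *)
Definition isometric n (V : {set sv n}) : Prop :=
  forall u w, u \in V -> w \in V -> exists p, geodesic V u w p.

Definition partial_cube n (V : {set sv n}) : Prop :=
  V != set0 /\ isometric V.

(* coordinates that are not constant on V: exactly the coordinates of the
   minimal (isometric) embedding of V, i.e. its Theta-classes *)
Definition ncoord n (V : {set sv n}) (i : 'I_n) : bool :=
  [exists u in V, exists w in V, u i != w i].

(* -v with respect to the minimal embedding of V *)
Definition antipode n (V : {set sv n}) (v : sv n) : sv n :=
  [ffun i => if ncoord V i then ~~ v i else v i].

Definition antipodal n (V : {set sv n}) : Prop :=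
  forall v, v \in V -> antipode V v \in V.

(* W is convex in the partial cube V: contains all shortest paths of V
   between its vertices (in a partial cube these are the walks of length
   equal to the Hamming distance) *)
Definition convex n (V W : {set sv n}) : Prop :=
  W \subset V /\
  forall u w p, u \in W -> w \in W -> geodesic V u w p -> all (fun x => x \in W) p.

(* W is gated in the partial cube V (graph distance of V = Hamming distance) *)
Definition gated n (V W : {set sv n}) : Prop :=
  forall x, x \in V -> exists2 x', x' \in W &
    forall y, y \in W -> hamming x x' + hamming x' y = hamming x y.

Definition antipodal_sub n (V W : {set sv n}) : Prop :=
  [/\ convex V W, partial_cube W & antipodal W].

Definition maximal_antipodal_sub n (V W : {set sv n}) : Prop :=
  antipodal_sub V W /\
  forall W', antipodal_sub V W' -> W \subset W' -> W' = W.

Definition maximal_proper_antipodal_sub n (V W : {set sv n}) : Prop :=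
  [/\ antipodal_sub V W, W != V &
      forall W', antipodal_sub V W' -> W' != V -> W \subset W' -> W' = W].

Definition COM n (V : {set sv n}) : Prop :=
  partial_cube V /\ forall W, antipodal_sub V W -> gated V W.

Definition OM n (V : {set sv n}) : Prop := COM V /\ antipodal V.

(* rank: largest r such that Q_r is obtained by contracting Theta-classes;
   contracting the classes outside S is projecting onto the coordinates S,
   so this is the largest #|S| such that V projects onto all of {+,-}^S *)
Definition shattered n (V : {set sv n}) (S : {set 'I_n}) : bool :=
  [forall f : sv n, [exists v in V, [forall i in S, v i == f i]]].

Definition rank n (V : {set sv n}) : nat :=
  \max_(S : {set 'I_n} | shattered V S) #|S|.

Definition ext n (v : sv n) (b : bool) : sv n.+1 :=
  [ffun i : 'I_n.+1 => if unlift ord_max i is Some j then v j else b].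

(* the expansion G' of H along H1, H2: new Theta-class E = last coordinate,
   H1 = image of E^+, H2 = image of E^- *)
Definition expansion_set n (H1 H2 : {set sv n}) : {set sv n.+1} :=
  [set ext v true | v in H1] :|: [set ext v false | v in H2].

Definition gen_pos_OM_expansion n (H H1 H2 : {set sv n}) : Prop :=
  [/\ H1 :|: H2 = H,
      H1 :&: H2 != set0,            (* E is a nonempty Theta-class of G' *)
      OM (expansion_set H1 H2) &
      forall W, maximal_proper_antipodal_sub H W ->
        (W \subset H1 \/ W \subset H2) /\ ~~ (W \subset H1 :&: H2)].

Definition OM_corner n (H C : {set sv n}) : Prop :=
  (exists H1 H2, gen_pos_OM_expansion H H1 H2 /\ C = H :\: H1) \/
  (rank H <= 1 /\ exists2 v, v \in H & C = [set v]).

Definition corner n (G C : {set sv n}) : Prop :=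
  exists H, [/\ maximal_antipodal_sub G H, C \subset H,
    (forall H', maximal_antipodal_sub G H' -> H' != H -> [disjoint H' & C])
    & OM_corner H C].

Definition corner_peeling n (G : {set sv n}) (Cs : seq {set sv n}) : Prop :=
  [/\ all (fun C => C != set0) Cs,
      (forall i j, i < j < size Cs -> [disjoint nth set0 Cs i & nth set0 Cs j]),
      \bigcup_(C <- Cs) C = G &
      forall i, i < size Cs ->
        let R := G :\: \bigcup_(j < i) nth set0 Cs j in
        COM R /\ corner R (nth set0 Cs i)].

(* Main.v *)
Require Import Defs.
From mathcomp Require Import all_boot all_order.
Set Implicit Arguments. Unset Strict Implicit. Unset Printing Implicit Defensive.

(* A pair of coordinates k, j crossed by an even cycle H of G cuts out a wedge
   {x in G | x k = b k, x j = a j}. When this wedge lies in H it is a path missing only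
   one vertex of a half of the cycle; removing it, respectively its antipode, from H gives
   the two sides of an expansion of H to a longer even cycle, so the wedge is a corner,
   and deleting it from G leaves a COM.
   To find such a wedge, call it free if it sees just one k-edge, and take a set of
   minimum size among all halfspaces and all free wedges.  Since the k-edges form a
   laminar family (rank 2), an end of this family spans, with a nearest k-edge, a cycle
   whose wedge is free; this shrinks every halfspace that is not a leaf and every wedge
   that is not free for j as well.  A wedge free for both k and j but not inside H
   contains a whole halfspace. *)

(** The obstacle is that a wedge of a cycle [H] may contain vertices of [G] outside [H], and is then
    no corner. Freeness controls such leaks: a wedge free for both [k] and [j] has a single exit
    across either class, and both exits lie on [H]. If the wedge leaks out of [H] along a class [i]
    that does not cross [H], the halfspace of [i] away from [H] contains neither exit, so it is
    trapped in the wedge. Conversely a halfspace bounded by several edges contains a free wedge.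
    Each kind of set can thus shrink to the other, which is why both enter one minimisation. Cycles
    come from two [k]-edges with no third one between them: a geodesic across [k] within their span
    has to use one of the two, and this leaves only a chain of vertices on each side of [k]. *)

Definition flip n (i : 'I_n) (v : sv n) : sv n :=
  [ffun l => if l == i then ~~ v l else v l].

Definition between n (u x w : sv n) : Prop :=
  forall i, x i = u i \/ x i = w i.

(** Isometry in local form. Once [isometricP] and [convexP] have translated the definitions, no
    walks are needed. *)
Definition stepwise n (V : {set sv n}) : Prop :=
  forall u w, u \in V -> w \in V -> u != w ->
  exists2 i, u i != w i & flip i u \in V.

Definition interval_closed n (V W : {set sv n}) : Prop :=
  forall u w x, u \in W -> w \in W -> x \in V -> between u x w -> x \in W.

(** * Intervals, isometry and gates in the hypercube *)

Section Distance.
Variable n : nat.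
Implicit Types (u v w x y z : sv n) (i k : 'I_n) (V W : {set sv n}).

Lemma flip_id i v : flip i v i = ~~ v i.
Proof. by rewrite ffunE eqxx. Qed.

Lemma flip_ne i l v : l != i -> flip i v l = v l.
Proof. by rewrite ffunE => /negbTE ->. Qed.

Lemma flipK i : involutive (flip i).
Proof. by move=> v; apply/ffunP=> l; rewrite !ffunE; case: eqP => //; rewrite negbK. Qed.

Lemma flip_neq i v : flip i v != v.
Proof. by apply/eqP=> /ffunP/(_ i); rewrite flip_id; case: (v i). Qed.

Lemma neq_coord u w : u != w -> exists i, u i != w i.
Proof.
move=> uw; apply/existsP; rewrite -negb_forall; apply: contra uw => /forallP E.
by apply/eqP/ffunP=> i; apply/eqP.
Qed.

Lemma hammingE u w : hamming u w = \sum_i (u i != w i).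
Proof.
by rewrite /hamming -sum1_card big_mkcond; apply: eq_bigr => i _; rewrite inE; case: eqP.
Qed.

Lemma hamming_leqif u x w :
  hamming u w <= hamming u x + hamming x w
    ?= iff [forall i, (x i == u i) || (x i == w i)].
Proof.
rewrite !hammingE -big_split /=.
have -> : [forall i, (x i == u i) || (x i == w i)]
        = [forall (i | true), (x i == u i) || (x i == w i)].
  by apply: eq_forallb.
by apply: leqif_sum => i _; case: (u i); case: (x i); case: (w i).
Qed.

Lemma hamming_between u x w :
  hamming u x + hamming x w = hamming u w <-> between u x w.
Proof.
have [_] := hamming_leqif u x w; rewrite eq_sym => E; split=> [H i|H].
  by move: E; rewrite H eqxx => /esym/forallP/(_ i)/orP[]/eqP; [left|right].
apply/eqP; rewrite E; apply/forallP=> i.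
by case: (H i) => ->; rewrite eqxx ?orbT.
Qed.

Lemma hamming_triangle u x w : hamming u w <= hamming u x + hamming x w.
Proof. by case: (hamming_leqif u x w). Qed.

Lemma hamming_eq0 u w : (hamming u w == 0) = (u == w).
Proof.
apply/idP/eqP => [|->]; last by rewrite hammingE big1 // => i _; rewrite eqxx.
rewrite cards_eq0 => /eqP E; apply/ffunP=> i.
by have := in_set0 i; rewrite -E inE => /negbFE/eqP.
Qed.

Lemma hamming_flip i u : hamming u (flip i u) = 1.
Proof.
apply/eqP/cards1P; exists i; apply/setP=> l; rewrite !inE ffunE.
by case: (l =P i) => _; rewrite ?eqxx //; case: (u l).
Qed.

Lemma hamming_step i u w : u i != w i -> hamming u w = (hamming (flip i u) w).+1.
Proof.
move=> ui; rewrite -add1n -(hamming_flip i u); apply/esym/hamming_between => l.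
rewrite ffunE; case: eqP => [->|]; last by left.
by right; move: ui; case: (u i); case: (w i).
Qed.

Lemma qadjP u w : qadj u w -> exists i, w = flip i u.
Proof.
move=> /cards1P[i /setP E]; exists i; apply/ffunP=> l; rewrite ffunE.
by have := E l; rewrite !inE => <-; case: (u l); case: (w l).
Qed.

Lemma path_hamming u p : path (@qadj n) u p -> hamming u (last u p) <= size p.
Proof.
elim: p u => [|x p IH] u /=; first by rewrite leqn0 hamming_eq0.
case/andP=> ux /IH le; apply: leq_trans (hamming_triangle u x _) _.
by rewrite (eqP ux) add1n.
Qed.

Lemma between_refll u w : between u u w.
Proof. by left. Qed.

Lemma between_sym u x w : between u x w -> between w x u.
Proof. by move=> B i; case: (B i); [right|left]. Qed.

Lemma betweenW u x y w : between u y w -> between u x y -> between u x w.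
Proof. by move=> By Bx i; case: (Bx i) => ->; [left|apply: By]. Qed.

Lemma isometricP V : isometric V <-> stepwise V.
Proof.
split=> [iV u w uV wV uw | sV u w].
  have [[|y p] [[/= pth lst al] sz]] := iV u w uV wV.
    by rewrite -lst eqxx in uw.
  case/andP: pth => uy pth; case/and3P: al => _ yV _.
  have [i Ey] := qadjP uy; exists i; last by rewrite -Ey.
  have le : hamming u y + hamming y w <= hamming u w.
    by rewrite (eqP uy) add1n -sz ltnS -lst path_hamming.
  have /hamming_between/(_ i) : hamming u y + hamming y w = hamming u w.
    by apply/eqP; rewrite eqn_leq le hamming_triangle.
  by rewrite Ey flip_id; case: (u i); case: (w i); case.
move: {2}(hamming u w) (erefl (hamming u w)) => m.
elim: m u => [|m IH] u E uV wV.
  move/eqP: E; rewrite hamming_eq0 => /eqP <-; exists [::].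
  by split; [split; rewrite //= uV | apply/esym/eqP; rewrite hamming_eq0].
have [|i ui fV] := sV u w uV wV; first by rewrite -hamming_eq0 E.
rewrite (hamming_step ui) in E; case: E => E.
have [p [[pth lst al] sz]] := IH _ E fV wV.
exists (flip i u :: p); split; last by rewrite /= sz (hamming_step ui).
split=> //=; last by rewrite uV.
by rewrite pth andbT /qadj hamming_flip.
Qed.

Lemma convexP V W : stepwise V ->
  convex V W <-> W \subset V /\ interval_closed V W.
Proof.
move=> sV; split=> [][WV H]; split=> //.
  move=> u w x uW wW xV /hamming_between B.
  have /isometricP iV := sV.
  have [p [[p1 p2 p3] p4]] := iV u x (subsetP WV _ uW) xV.
  have [q [[q1 q2 q3] q4]] := iV x w xV (subsetP WV _ wW).
  have gpq : geodesic V u w (p ++ q).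
    split; last by rewrite size_cat p4 q4.
    split; first by rewrite cat_path p1 p2.
      by rewrite last_cat p2.
    by move: q3; rewrite /= all_cat => /andP[_ ->]; rewrite andbT.
  have := H _ _ _ uW wW gpq; rewrite all_cat => /andP[/allP al _].
  have := mem_last u p; rewrite p2 inE => /orP[/eqP-> //|]; exact: al.
move=> u w p uW wW [[pth lst al] sz]; apply/allP=> x xp.
have xV : x \in V by case/andP: al => _ /allP; apply.
apply: (H u w x) => //; apply/hamming_between.
case/path.splitP: xp pth lst sz {al} => p1 p2.
rewrite cat_path last_cat last_rcons => /andP[h1 h2] lst sz.
apply/eqP; rewrite eqn_leq hamming_triangle andbT -sz size_cat leq_add //.
  by have := path_hamming h1; rewrite last_rcons.
by have := path_hamming h2; rewrite lst.
Qed.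

(** A geodesic from [x] to [y] flips [k] at some step, and [z] is the vertex just before it. Every
    later argument about leaving a region across a class rests on this edge. *)
Lemma crossing V k x y : stepwise V -> x \in V -> y \in V -> x k != y k ->
  exists z, [/\ z \in V, flip k z \in V, z k = x k & between x z y].
Proof.
move=> sV; move: {2}(hamming x y) (leqnn (hamming x y)) => m.
elim: m x => [|m IH] x le xV yV xy.
  by move: le xy; rewrite leqn0 hamming_eq0 => /eqP ->; rewrite eqxx.
have [|i xi fV] := sV x y xV yV; first by apply: contra xy => /eqP->.
case: (eqVneq k i) => [->|ki]; first by exists x; split=> //; apply: between_refll.
have fk : flip i x k = x k by rewrite flip_ne.
have [||||z [zV fz zk B]] := IH (flip i x); rewrite ?fk //.
  by rewrite -ltnS -(hamming_step xi).
exists z; split=> //; first by rewrite zk fk.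
move=> l; case: (B l) => ->; last by right.
rewrite ffunE; case: eqP => [->|]; last by left.
by right; move: xi; case: (x i); case: (y i).
Qed.

Lemma ncoordP V i :
  reflect (exists u w, [/\ u \in V, w \in V & u i != w i]) (ncoord V i).
Proof.
apply: (iffP existsP) => [[u /andP[uV /existsP[w /andP[wV d]]]]|[u [w [uV wV d]]]].
  by exists u, w.
by exists u; rewrite uV; apply/existsP; exists w; rewrite wV.
Qed.

Lemma ncoord_flip V i v : v \in V -> flip i v \in V -> ncoord V i.
Proof.
by move=> vV fV; apply/ncoordP; exists v, (flip i v); rewrite flip_id; case: (v i).
Qed.

Lemma nncoord V i u w : ~~ ncoord V i -> u \in V -> w \in V -> u i = w i.
Proof.
move=> nc uV wV; apply/eqP; apply: contraR nc => d; apply/ncoordP; by exists u, w.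
Qed.

(** On a class of [W] the gate lies between [x] and vertices of [W] of both signs, hence has the
    sign of [x]; elsewhere [W] is constant. So the gate is an explicit sign vector. *)
Lemma gated_gate V W w x : gated V W -> w \in W -> x \in V ->
  [ffun i => if ncoord W i then x i else w i] \in W.
Proof.
move=> gW wW xV; have [x' x'W H] := gW x xV.
suff -> : [ffun i => if ncoord W i then x i else w i] = x' by [].
apply/ffunP=> i; rewrite ffunE; case: ifPn => [/ncoordP|nc]; last exact: nncoord nc _ _.
case=> u [y [uW yW d]].
have /hamming_between/(_ i) := H u uW; have /hamming_between/(_ i) := H y yW.
by move: d; case: (x i); case: (x' i); case: (u i); case: (y i) => // _ [] // _ [].
Qed.

Lemma gate_gated V W :
  (forall x, x \in V -> exists2 x', x' \in W & forall i, ncoord W i -> x' i = x i) ->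
  gated V W.
Proof.
move=> H x /H[x' x'W E]; exists x' => // y yW; apply/hamming_between => i.
have [/E|nc] := boolP (ncoord W i); first by left.
by right; apply: nncoord nc _ _.
Qed.

End Distance.

(** * Antipodal subgraphs and graphs of maximum degree two *)

Definition deg2 n (V : {set sv n}) : Prop :=
  forall x i1 i2 i3, x \in V -> flip i1 x \in V -> flip i2 x \in V ->
  flip i3 x \in V -> [|| i1 == i2, i1 == i3 | i2 == i3].

Section Antipodal.
Variable n : nat.
Implicit Types (u v w x y z : sv n) (i k : 'I_n) (V W : {set sv n}).

Lemma antipode_nc V i v : ncoord V i -> antipode V v i = ~~ v i.
Proof. by rewrite ffunE => ->. Qed.

Lemma antipode_c V i v : ~~ ncoord V i -> antipode V v i = v i.
Proof. by rewrite ffunE => /negbTE->. Qed.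

Lemma antipodal_subE V W : stepwise V -> antipodal_sub V W <->
  [/\ W \subset V, interval_closed V W, W != set0, stepwise W & antipodal W].
Proof.
move=> sV; split=> [[/(convexP _ sV)[? ?] [? /isometricP ?] ?] //|[? ? ? ? ?]].
by split=> //; [apply/convexP | split=> //; apply/isometricP].
Qed.

Lemma COM_stepwise V : COM V -> stepwise V.
Proof. by case=> [[_ /isometricP]]. Qed.

Lemma gate_in V W w x : gated V W -> w \in W -> x \in V ->
  (forall i, ~~ ncoord W i -> x i = w i) -> x \in W.
Proof.
move=> gW wW xV E; suff <- : [ffun i => if ncoord W i then x i else w i] = x.
  exact: gated_gate gW wW xV.
by apply/ffunP=> i; rewrite ffunE; case: ifPn => // /E.
Qed.

Lemma edge_ncoord w i l : ncoord [set w; flip i w] l = (l == i).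
Proof.
apply/ncoordP/eqP => [[u [y []]]|->]; last first.
  exists w, (flip i w); rewrite !inE !eqxx orbT flip_id; split=> //.
  by case: (w i).
rewrite !inE => /orP[]/eqP-> /orP[]/eqP-> d; apply/eqP; apply: contraR d => li;
  by rewrite ?ffunE ?(negbTE li).
Qed.

Lemma edge_antipodal_sub V w i : stepwise V -> w \in V -> flip i w \in V ->
  antipodal_sub V [set w; flip i w].
Proof.
move=> sV wV fV; apply/antipodal_subE => //; split.
- by apply/subsetP=> x; rewrite !inE => /orP[]/eqP->.
- have E x : (forall l, l != i -> x l = w l) -> x \in [set w; flip i w].
    move=> xE; rewrite !inE; case: (eqVneq (x i) (w i)) => xi.
      by apply/orP; left; apply/eqP/ffunP=> l; case: (eqVneq l i) => [->//|/xE].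
    apply/orP; right; apply/eqP/ffunP=> l; case: (eqVneq l i) => [->|li].
      by rewrite flip_id; move: xi; case: (x i); case: (w i).
    by rewrite flip_ne // xE.
  move=> u y x uW yW _ B; apply: E => l li.
  by move: uW yW (B l); rewrite !inE => /orP[]/eqP-> /orP[]/eqP->; rewrite ?flip_ne //; case.
- by apply/set0Pn; exists w; rewrite !inE eqxx.
- move=> u y; rewrite !inE => /orP[]/eqP-> /orP[]/eqP->; rewrite ?eqxx // => _.
    by exists i; rewrite ?flip_id ?inE ?eqxx ?orbT //; case: (w i).
  by exists i; rewrite ?flip_id ?flipK ?inE ?eqxx ?orbT //; case: (w i).
- suff E u : antipode [set w; flip i w] u = flip i u.
    by move=> u; rewrite E !inE => /orP[]/eqP->; rewrite ?flipK eqxx ?orbT.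
  by apply/ffunP=> l; rewrite !ffunE edge_ncoord.
Qed.

(** If two classes cross [W], each vertex of [W] has two neighbours in [W]: step along [i1] towards
    its antipode, then take a step towards the antipode of [flip i1 w], which cannot use [i1]. By
    the degree bound [W] then contains all neighbours of its vertices, and connectedness gives
    [W = V]. *)
Lemma deg2_antipodal_sub V W : stepwise V -> deg2 V -> antipodal_sub V W ->
  [\/ W = V, exists w i, W = [set w; flip i w] | exists w, W = [set w]].
Proof.
move=> sV dV /(antipodal_subE _ sV) [WV cW /set0Pn[w0 w0W] sW aW].
case: (pickP (ncoord W)) => [i ni|nc]; last first.
  apply: Or33; exists w0; apply/setP=> w; rewrite inE; apply/idP/eqP=> [wW|->//].
  by apply/ffunP=> l; apply: nncoord wW w0W; rewrite nc.
case: (pickP [pred l | ncoord W l & l != i]) => [j /= /andP[nj ji]|nc]; last first.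
  have nW l : ncoord W l = (l == i).
    have := nc l; rewrite /=; case: (eqVneq l i) => [->|_]; first by rewrite ni.
    by rewrite andbT.
  apply: Or32; exists w0, i; apply/setP=> w; rewrite !inE.
  have fE x : antipode W x = flip i x by apply/ffunP=> l; rewrite !ffunE nW.
  apply/idP/orP => [wW|[]/eqP->//]; last by rewrite -fE; apply: aW.
  case: (eqVneq (w i) (w0 i)) => wi; [left|right]; apply/eqP/ffunP=> l.
    by case: (eqVneq l i) => [->//|li]; apply: nncoord wW w0W; rewrite nW.
  case: (eqVneq l i) => [->|li].
    by rewrite flip_id; move: wi; case: (w i); case: (w0 i).
  by rewrite flip_ne //; apply: nncoord wW w0W; rewrite nW.
have two w : w \in W -> exists i1 i2, [/\ i1 != i2, flip i1 w \in W & flip i2 w \in W].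
  move=> wW; have [|i1 i1w f1] := sW _ _ wW (aW _ wW).
    by apply/eqP=> /ffunP/(_ i); rewrite antipode_nc //; case: (w i).
  have n1 : ncoord W i1 := ncoord_flip wW f1.
  have [l nl l1] : exists2 l, ncoord W l & l != i1.
    by case: (eqVneq i i1) => [<-|]; [exists j | exists i].
  have [|i2 i2w f2] := sW _ _ wW (aW _ f1).
    by apply/eqP=> /ffunP/(_ l); rewrite antipode_nc // flip_ne //; case: (w l).
  exists i1, i2; split=> //; apply: contraNneq i2w => <-.
  by rewrite antipode_nc // flip_id negbK.
apply: Or31; apply/eqP; rewrite eqEsubset WV /=; apply/subsetP=> x xV.
move: {2}(hamming w0 x) (leqnn (hamming w0 x)) w0W => m.
elim: m w0 => [|m IH] w le wW.
  by move: le; rewrite leqn0 hamming_eq0 => /eqP <-.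
case: (eqVneq w x) => [<-//|wx].
have wV := subsetP WV _ wW.
have [l lw fV] := sV _ _ wV xV wx.
rewrite (hamming_step lw) ltnS in le; apply: IH le _.
have [i1 [i2 [i12 f1 f2]]] := two w wW.
have := dV w _ _ _ wV fV (subsetP WV _ f1) (subsetP WV _ f2).
by rewrite (negbTE i12) orbF => /orP[]/eqP->.
Qed.

Lemma deg2_COM V : V != set0 -> stepwise V -> deg2 V -> COM V.
Proof.
move=> V0 sV dV; split; first by split=> //; apply/isometricP.
move=> W aW; apply: gate_gated => x xV.
have [->|[w [i E]]|[w E]] := deg2_antipodal_sub sV dV aW; first by exists x.
  rewrite E; case: (eqVneq (x i) (w i)) => xi.
    exists w; first by rewrite !inE eqxx.
    by move=> l; rewrite edge_ncoord => /eqP->.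
  exists (flip i w); first by rewrite !inE eqxx orbT.
  by move=> l; rewrite edge_ncoord => /eqP->; rewrite flip_id; move: xi; case: (x i); case: (w i).
rewrite E; exists w; first by rewrite inE.
by move=> l /ncoordP[u [y []]]; rewrite !inE => /eqP-> /eqP->; rewrite eqxx.
Qed.

End Antipodal.

(* An even cycle H with an antipodal pair a, b such that the first step from a to b is
   along k on one side and along j on the other. *)
Record wedge_cell n (H : {set sv n}) (k j : 'I_n) (a b : sv n) : Prop := WedgeCell {
  wc_step : stepwise H;
  wc_anti : antipodal H;
  wc_deg2 : deg2 H;
  wc_a : a \in H;
  wc_b : b \in H;
  wc_ka : flip k a \in H;
  wc_ja : flip j a \in H;
  wc_kb : flip k b \in H;
  wc_jb : flip j b \in H;
  wc_k : a k != b k;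
  wc_j : a j != b j;
  wc_kj : k != j;
  wc_ua : forall x, x \in H -> x k = a k -> x j = a j -> x = a;
  wc_ub : forall x, x \in H -> x k = b k -> x j = b j -> x = b }.

(** The vertices that have crossed [k] but not yet [j] on the way from [a] to [b]. In the cycle this
    is the interior of one of the two paths from [a] to [b]; exchanging [a] and [b] gives the
    other. *)
Definition wedge n (V : {set sv n}) (k j : 'I_n) (a b : sv n) : {set sv n} :=
  [set x in V | (x k == b k) && (x j == a j)].

Lemma wedge_cellO n (H : {set sv n}) k j a b :
  wedge_cell H k j a b -> wedge_cell H k j b a.
Proof. by case=> *; split=> //; rewrite eq_sym. Qed.

(** * Deleting a wedge preserves isometry *)

Section WedgeRemoval.
Variables (n : nat) (G H : {set sv n}) (k j : 'I_n) (a b : sv n).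
Hypotheses (sG : stepwise G) (wH : wedge_cell H k j a b) (HG : H \subset G).
Hypothesis Hfull : forall x h, x \in G -> h \in H ->
  (forall i, ~~ ncoord H i -> x i = h i) -> x \in H.
Hypothesis FH : wedge G k j a b \subset H.

Lemma flip_full i x : x \in G -> ncoord H i -> flip i x \in H -> x \in H.
Proof.
move=> xG ni fH; apply: Hfull fH _ => // l nl; rewrite flip_ne //.
by apply: contraNneq nl => ->.
Qed.

Lemma wedge_ncoordk : ncoord H k.
Proof. exact: ncoord_flip (wc_a wH) (wc_ka wH). Qed.

Lemma wedge_ncoordj : ncoord H j.
Proof. exact: ncoord_flip (wc_a wH) (wc_ja wH). Qed.

(** A step into the wedge crosses [k] or [j], and [Hfull] forces it to start at [a] or [b]
    respectively. The target is outside the wedge, so it also differs from the start in the other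
    class, and that step stays on the cycle outside the wedge. Assuming [Hfull] instead of gatedness
    lets the lemma apply to [G = H] too. *)
Lemma stepwise_setD_wedge : stepwise (G :\: wedge G k j a b).
Proof.
have [[kj ak] aj] := (wc_kj wH, wc_k wH, wc_j wH).
move=> u w; rewrite 2!in_setD => /andP[uF uG] /andP[wF wG] uw.
rewrite inE uG /= in uF; rewrite inE wG /= in wF.
have [i iu fG] := sG uG wG uw.
have [fF|fF] := boolP (flip i u \in wedge G k j a b); last by exists i; rewrite // inE fF.
have fH := subsetP FH _ fF; move: fF; rewrite inE => /and3P[_ /eqP fk /eqP fj].
case: (eqVneq i k) iu fG fH fk fj => [->|ik] iu fG fH.
  rewrite flip_id => fk; rewrite flip_ne 1?eq_sym // => fj.
  have uk : u k = a k by move: ak fk; case: (u k); case: (a k); case: (b k).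
  have uH := flip_full uG wedge_ncoordk fH.
  have ua : u = a by apply: (wc_ua wH).
  have wk : w k = b k by move: ak iu; rewrite uk; case: (w k); case: (a k); case: (b k).
  move: wF; rewrite wk eqxx /= => wj; exists j; first by rewrite fj eq_sym.
  rewrite !inE ua (subsetP HG _ (wc_ja wH)) /= (flip_ne _ kj) andbT.
  by rewrite (negbTE ak).
case: (eqVneq i j) iu fG fH => [->|ij] iu fG fH fk fj; last first.
  by move: uF; rewrite -fk -fj !flip_ne ?eqxx // eq_sym.
have uk : u k = b k by rewrite -fk flip_ne.
have uj : u j = b j by move: aj fj; rewrite flip_id; case: (u j); case: (a j); case: (b j).
have uH := flip_full uG wedge_ncoordj fH.
have ub : u = b by apply: (wc_ub wH).
have wj : w j = a j by move: aj iu; rewrite uj; case: (w j); case: (a j); case: (b j).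
move: wF; rewrite wj eqxx andbT => wk; exists k; first by rewrite uk eq_sym.
rewrite !inE ub (subsetP HG _ (wc_kb wH)) /= andbT (flip_ne _ (_ : j != k)) 1?eq_sym //.
by rewrite [b j == _]eq_sym (negbTE aj) andbF.
Qed.

End WedgeRemoval.

(** * Gates after a deletion, and uniqueness of the maximal antipodal subgraph *)

Section Removal.
Variable n : nat.
Implicit Types (u v w x y z : sv n) (i k : 'I_n) (V W G R : {set sv n}).

(** An antipodal subgraph of [R] that is convex in [G] is an antipodal subgraph of [G], and its
    gates in [G] serve the vertices of [R]. *)
Lemma COM_subset G R : COM G -> R \subset G -> R != set0 -> stepwise R ->
  (forall W, antipodal_sub R W -> interval_closed G W) -> COM R.
Proof.
move=> cG RG R0 sR cR; split; first by split=> //; apply/isometricP.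
move=> W aW; have [WR _ W0 sW aaW] := (antipodal_subE _ sR).1 aW.
have /cG.2 gW : antipodal_sub G W.
  apply/antipodal_subE; first exact: COM_stepwise.
  by split=> //; [apply: subset_trans WR RG | apply: cR].
by move=> x /(subsetP RG)/gW.
Qed.

(** By [COM_subset], the only danger is an antipodal [W] in the remainder with an interval through
    the wedge. Such an interval enters and leaves at [a] and [b], which pulls both into [W]. *)
Lemma COM_setD_wedge G H k j a b : COM G -> antipodal_sub G H ->
  wedge_cell H k j a b -> wedge G k j a b \subset H -> COM (G :\: wedge G k j a b).
Proof.
move=> cG aH wH FH; have sG := COM_stepwise cG.
have [HG _ _ _ _] := (antipodal_subE _ sG).1 aH.
have gH := cG.2 _ aH.
have Hf x h : x \in G -> h \in H ->
    (forall i, ~~ ncoord H i -> x i = h i) -> x \in H.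
  by move=> xG hH; apply: gate_in gH hH xG.
have sR := stepwise_setD_wedge sG wH HG Hf FH.
have [[kj ak] aj] := (wc_kj wH, wc_k wH, wc_j wH).
have [aG bG] := (subsetP HG _ (wc_a wH), subsetP HG _ (wc_b wH)).
have inR x : (x \in G :\: wedge G k j a b) = (x \in G) && ~~ ((x k == b k) && (x j == a j)).
  by rewrite in_setD inE; case: (x \in G); rewrite ?andbT ?andbF.
have aR : a \in G :\: wedge G k j a b by rewrite inR aG (negbTE ak).
have bR : b \in G :\: wedge G k j a b.
  by rewrite inR bG [b j == _]eq_sym (negbTE aj) andbF.
apply: (COM_subset cG (subsetDl _ _) _ sR); first by apply/set0Pn; exists a.
move=> W /(antipodal_subE _ sR) [WR cW _ _ aW].
suff key u w x : u \in W -> w \in W -> x \in G -> between u x w ->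
    x k = b k -> x j = a j -> u k = b k -> False.
  move=> u w x uW wW xG B.
  have [xR|] := boolP (x \in G :\: wedge G k j a b).
    exact: cW uW wW xR B.
  rewrite inR xG /= negbK => /andP[/eqP xk /eqP xj].
  case: (B k) => e; first by case: (key u w x) => //; rewrite -e.
  by case: (key w u x) => //; [apply: between_sym | rewrite -e].
move=> uW wW xG B xk xj uk.
have := subsetP WR _ uW; rewrite inR uk eqxx /= => /andP[uG uj].
have := subsetP WR _ wW; rewrite inR => /andP[wG wF].
have wj : w j = a j by rewrite -xj; case: (B j) => // e; rewrite -e xj eqxx in uj.
rewrite wj eqxx andbT in wF.
(* The exit from the wedge towards [u] crosses [j] inside [H], so it arrives at [b]. *)
have [|z [zG fz zj Bz]] := @crossing _ _ j x u sG xG uG; first by rewrite xj eq_sym.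
have zk : z k = b k by case: (Bz k) => ->.
have zH : z \in H by apply: (subsetP FH); rewrite inE zG zk zj xj !eqxx.
have fH : flip j z \in H.
  apply: (gate_in gH zH fz) => l nl; apply: flip_ne.
  by apply: contraNneq nl => ->; apply: wedge_ncoordj wH.
have fb : flip j z = b.
  apply: (wc_ub wH) => //; first by rewrite flip_ne.
  by rewrite flip_id zj xj; move: aj; case: (a j); case: (b j).
have bW : b \in W.
  apply: (cW u w) => //; apply: betweenW B _; apply: between_sym.
  rewrite -fb => l; case: (eqVneq l j) => [->|lj]; last by rewrite flip_ne.
  right; rewrite flip_id zj; move: uj; rewrite xj.
  by case: (u j); case: (a j).
(* The exit towards [w] crosses [k] and arrives at [a]. *)
have [|y [yG fy yk By]] := @crossing _ _ k x w sG xG wG; first by rewrite xk eq_sym.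
have yj : y j = a j by case: (By j) => ->; rewrite ?xj ?wj.
have yH : y \in H by apply: (subsetP FH); rewrite inE yG yj yk xk !eqxx.
have fyH : flip k y \in H.
  apply: (gate_in gH yH fy) => l nl; apply: flip_ne.
  by apply: contraNneq nl => ->; apply: wedge_ncoordk wH.
have fa : flip k y = a.
  apply: (wc_ua wH) => //; last by rewrite flip_ne // eq_sym.
  by rewrite flip_id yk xk; move: ak; case: (a k); case: (b k).
have aaW : a \in W.
  apply: (cW u w) => //; apply: between_sym; apply: betweenW (between_sym B) _.
  apply: between_sym.
  rewrite -fa => l; case: (eqVneq l k) => [->|lk]; last by rewrite flip_ne.
  right; rewrite flip_id yk; move: wF; rewrite xk.
  by case: (w k); case: (b k).
have fjR : flip j a \in G :\: wedge G k j a b.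
  rewrite inR (subsetP HG _ (wc_ja wH)) flip_ne //.
  by rewrite (negbTE ak).
have fjW : flip j a \in W.
  apply: (cW a b) => // l; case: (eqVneq l j) => [->|lj]; last by left; rewrite flip_ne.
  by right; rewrite flip_id; move: aj; case: (a j); case: (b j).
(* [W] is crossed by [k] and [j], so the antipode of [flip j a] in [W] has the signs of the deleted
   wedge. *)
have nW l : a l != b l -> ncoord W l by move=> d; apply/ncoordP; exists a, b.
have := subsetP WR _ (aW _ fjW); rewrite inR !antipode_nc ?nW //.
rewrite flip_id flip_ne // negbK eqxx andbT.
by move: ak; case: (a k); case: (b k); rewrite ?andbF.
Qed.

(** Send [c] to its antipode in [H], then to the gate in [W], then to the antipode in [W]. The
    result agrees with [c] on the classes of [H], so it equals [c]; but a class of [W] that is not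
    one of [H] would have been flipped exactly once. *)
Lemma antipodal_sub_meet G H c W : COM G -> antipodal_sub G H -> c \in H ->
  (forall x, x \in G -> (forall i, ncoord H i -> x i = c i) -> x = c) ->
  antipodal_sub G W -> c \in W -> W \subset H.
Proof.
move=> cG aH cH fib aW cW; have sG := COM_stepwise cG.
have [HG _ _ _ aaH] := (antipodal_subE _ sG).1 aH.
have [WG _ _ _ aaW] := (antipodal_subE _ sG).1 aW.
have p'W := aaW _ (gated_gate (cG.2 _ aW) cW (subsetP HG _ (aaH _ cH))).
have E := fib _ (subsetP WG _ p'W).
have sub i : ncoord W i -> ncoord H i.
  move=> ni; apply: contraT => nH; suff /E/ffunP/(_ i) : forall l, ncoord H l ->
     antipode W [ffun l => if ncoord W l then antipode H c l else c l] l = c l.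
    by rewrite antipode_nc // ffunE ni antipode_c //; case: (c i).
  move=> l nl; case: (boolP (ncoord W l)) => nW.
    by rewrite antipode_nc // ffunE nW antipode_nc // negbK.
  by rewrite antipode_c // ffunE (negbTE nW).
apply/subsetP=> x xW; apply: (gate_in (cG.2 _ aH) cH (subsetP WG _ xW)) => l nl.
by apply: nncoord xW cW; apply: contra nl; apply: sub.
Qed.

Lemma corner_cell G H (C : {set sv n}) : COM G -> antipodal_sub G H -> C \subset H -> C != set0 ->
  (forall c x, c \in C -> x \in G -> (forall i, ncoord H i -> x i = c i) -> x = c) ->
  OM_corner H C -> corner G C.
Proof.
move=> cG aH CH C0 fib oC; exists H.
have sub W c : antipodal_sub G W -> c \in C -> c \in W -> W \subset H.
  move=> aW cC cW; apply: antipodal_sub_meet cG aH _ _ aW cW.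
    exact: subsetP CH _ cC.
  by move=> x xG; apply: fib.
split=> //.
  split=> // W aW HW; apply/eqP; rewrite eqEsubset HW andbT.
  by have /set0Pn[c cC] := C0; apply: (sub W c) => //; apply/(subsetP HW)/(subsetP CH).
move=> W [aW mW] WH; rewrite -setI_eq0; apply: contraT => /set0Pn[c].
rewrite inE => /andP[cW cC]; have := sub _ _ aW cC cW.
by move/(mW H aH) => E; rewrite E eqxx in WH.
Qed.

End Removal.

(** * Coordinates of an expansion *)

Section Expansion.
Variable n : nat.
Implicit Types (x y : sv n) (b : bool).

Lemma ext_max x b : ext x b ord_max = b.
Proof. by rewrite ffunE unlift_none. Qed.

Lemma ext_lift x b i : ext x b (lift ord_max i) = x i.
Proof. by rewrite ffunE liftK. Qed.

Lemma ext_inj x y b c : ext x b = ext y c -> x = y /\ b = c.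
Proof.
move=> E; split; last by rewrite -(ext_max x b) E ext_max.
by apply/ffunP=> i; rewrite -(ext_lift x b) E ext_lift.
Qed.

Lemma extP (y : sv n.+1) : exists x b, y = ext x b.
Proof.
exists [ffun i => y (lift ord_max i)], (y ord_max); apply/ffunP=> l.
by rewrite ffunE; case: unliftP => [i ->|->]; rewrite ?ffunE.
Qed.

Lemma flip_ext_max x b : flip ord_max (ext x b) = ext x (~~ b).
Proof.
apply/ffunP=> l; case: (unliftP ord_max l) => [i ->|->]; last by rewrite flip_id !ext_max.
by rewrite flip_ne ?ext_lift // eq_sym neq_lift.
Qed.

Lemma flip_ext_lift i x b : flip (lift ord_max i) (ext x b) = ext (flip i x) b.
Proof.
apply/ffunP=> l; case: (unliftP ord_max l) => [j ->|->]; last first.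
  by rewrite flip_ne ?ext_max // neq_lift.
by rewrite ffunE !ext_lift ffunE (inj_eq lift_inj).
Qed.

Lemma in_expansion (H1 H2 : {set sv n}) x b :
  (ext x b \in expansion_set H1 H2) = (x \in if b then H1 else H2).
Proof.
rewrite inE; apply/orP/idP => [[]/imsetP[y yH /ext_inj[-> ->]]//|].
by case: b => xH; [left|right]; apply: imset_f.
Qed.

End Expansion.

(** * Expanding an even cycle along two antipodal wedges *)

Section WedgeExpansion.
Variables (n : nat) (H : {set sv n}) (k j : 'I_n) (a b : sv n).
Hypothesis wH : wedge_cell H k j a b.

Let kj := wc_kj wH.
Let ak := wc_k wH.
Let aj := wc_j wH.
Let sH := wc_step wH.
(** The two paths of the cycle from [a] to [b], ends included. They share only these ends, so the
    expansion is a cycle longer by two. *)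
Let side (c : bool) := H :\: (if c then wedge H k j a b else wedge H k j b a).

Let in_side c x : (x \in side c) = (x \in H) &&
  (if c then (x k == a k) || (x j == b j) else (x k == b k) || (x j == a j)).
Proof.
rewrite /side in_setD; case: c; rewrite inE; case: (x \in H); rewrite ?andbF //= andbT negb_and;
by move: ak aj; case: (x k); case: (a k); case: (b k); case: (x j); case: (a j); case: (b j).
Qed.

Let side_cap x : x \in side true -> x \in side false -> x = a \/ x = b.
Proof.
rewrite !in_side => /andP[xH h1] /andP[_ h2].
case: (eqVneq (x k) (a k)) h1 h2 => [e|ne] /= h1 h2.
  left; apply: (wc_ua wH) => //; move: h2; rewrite e (negbTE ak) /=.
  by move/eqP.
right; apply: (wc_ub wH) => //; last exact/eqP.
by move: ne ak; case: (x k); case: (a k); case: (b k).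
Qed.

Let side_a c : a \in side c.
Proof. by rewrite in_side (wc_a wH); case: c; rewrite eqxx ?orbT. Qed.

Let side_step c : stepwise (side c).
Proof.
rewrite /side; case: c.
  by apply: (stepwise_setD_wedge sH wH) => //; apply/subsetP=> x; rewrite inE => /andP[].
apply: (stepwise_setD_wedge sH (wedge_cellO wH)) => //.
by apply/subsetP=> x; rewrite inE => /andP[].
Qed.

Let side_cup x : x \in H -> exists c, x \in side c.
Proof.
move=> xH; case E: (x \in side true); first by exists true.
exists false; move: E; rewrite !in_side xH /=.
by move: ak aj; case: (x k); case: (a k); case: (b k); case: (x j); case: (a j); case: (b j).
Qed.

(** Opposite wedges differ in both [k] and [j], so a single flip cannot lead from one to the
    other. *)
Let side_flip c i x : x \in side c -> x \notin side (~~ c) -> flip i x \in H ->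
  flip i x \in side c.
Proof.
rewrite !in_side => /andP[-> h1]; rewrite negb_and /= => h2 ->.
rewrite !ffunE; move: kj h1 h2.
case: (eqVneq k i) => [<-|ki]; first rewrite [j == k]eq_sym => /negbTE ->;
  case: c; move: ak aj;
  case: (j == i); case: (x k); case: (a k); case: (b k); case: (x j); case: (a j); by case: (b j).
Qed.

Let side_antipode c x : x \in side c -> antipode H x \in side (~~ c).
Proof.
rewrite !in_side => /andP[xH h]; rewrite (wc_anti wH) //= !antipode_nc.
- by move: ak aj h; case: c; case: (x k); case: (a k); case: (b k); case: (x j); case: (a j); case: (b j).
- exact: wedge_ncoordj wH.
- exact: wedge_ncoordk wH.
Qed.

(** At [a] and at [b] the two neighbours lie on different sides. Each copy keeps one of them and
    gains the new edge, so the degree stays two. *)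
Let side_deg c x i1 i2 : x \in side true -> x \in side false ->
  flip i1 x \in side c -> flip i2 x \in side c -> i1 = i2.
Proof.
move=> h1 h2 f1 f2; have inH d y : y \in side d -> y \in H by rewrite in_side => /andP[].
have H1 := inH _ _ f1; have H2 := inH _ _ f2.
have jk : j != k by rewrite eq_sym.
have E (l : 'I_n) : [|| k == j, k == l | j == l] -> l = k \/ l = j.
  by rewrite (negbTE kj) /= => /orP[]/eqP->; [left|right].
have [xa|xb] := side_cap h1 h2; [subst x|subst x].
  have := E _ (wc_deg2 wH (wc_a wH) (wc_ka wH) (wc_ja wH) H1).
  have := E _ (wc_deg2 wH (wc_a wH) (wc_ka wH) (wc_ja wH) H2).
  case=> E2; case=> E1; subst i1 i2 => //; exfalso; move: f1 f2;
  rewrite !in_side !flip_id !flip_ne //; move: ak aj; case: (c);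
  by case: (a k); case: (b k); case: (a j); case: (b j); rewrite /= ?andbF.
have := E _ (wc_deg2 wH (wc_b wH) (wc_kb wH) (wc_jb wH) H1).
have := E _ (wc_deg2 wH (wc_b wH) (wc_kb wH) (wc_jb wH) H2).
case=> E2; case=> E1; subst i1 i2 => //; exfalso; move: f1 f2;
rewrite !in_side !flip_id !flip_ne //; move: ak aj; case: (c);
by case: (a k); case: (b k); case: (a j); case: (b j); rewrite /= ?andbF.
Qed.

Let E := expansion_set (side true) (side false).

Let in_E c x : (ext x c \in E) = (x \in side c).
Proof. by rewrite in_expansion; case: c. Qed.

Let E_step : stepwise E.
Proof.
move=> u w; have [x [c ->]] := extP u; have [y [d ->]] := extP w.
rewrite !in_E => xc yd; case: (eqVneq c d) yd => [<-|cd] yd uw.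
  have [|i xi fi] := side_step xc yd; first by apply: contra uw => /eqP->.
  by exists (lift ord_max i); rewrite ?ext_lift // flip_ext_lift in_E.
have dc : d = ~~ c by move: cd; case: (c); case: (d).
have [xd|xd] := boolP (x \in side (~~ c)).
  by exists ord_max; rewrite ?ext_max // flip_ext_max in_E.
have inH e z : z \in side e -> z \in H by rewrite in_side => /andP[].
have [|i xi fi] := sH (inH _ _ xc) (inH _ _ yd).
  by apply: contraNneq xd => ->; rewrite -dc.
exists (lift ord_max i); rewrite ?ext_lift // flip_ext_lift in_E.
exact: side_flip.
Qed.

Let E_deg2 : deg2 E.
Proof.
move=> u i1 i2 i3; have [x [c ->]] := extP u.
have inH e z : z \in side e -> z \in H by rewrite in_side => /andP[].
have two l1 l2 : x \in side c -> flip ord_max (ext x c) \in E ->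
    flip l1 x \in side c -> flip l2 x \in side c -> l1 = l2.
  rewrite flip_ext_max in_E => h1 h2; have [] : x \in side true /\ x \in side false.
    by move: h1 h2; case: (c).
  exact: side_deg.
rewrite in_E; case: (unliftP ord_max i1) => [l1 ->|->];
case: (unliftP ord_max i2) => [l2 ->|->];
case: (unliftP ord_max i3) => [l3 ->|->]; rewrite ?eqxx ?orbT // ?flip_ext_lift ?in_E
  => xc f1 f2 f3; rewrite ?(inj_eq lift_inj).
- exact: (wc_deg2 wH (inH _ _ xc) (inH _ _ f1) (inH _ _ f2) (inH _ _ f3)).
- by rewrite (two l1 l2) ?eqxx.
- by rewrite (two l1 l3) ?eqxx ?orbT.
- by rewrite (two l2 l3) ?eqxx ?orbT.
Qed.

Let E_anti : antipodal E.
Proof.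
have inH e z : z \in side e -> z \in H by rewrite in_side => /andP[].
have Nmax : ncoord E ord_max.
  apply/ncoordP; exists (ext a true), (ext a false).
  by rewrite !in_E !ext_max.
have Nlift i : ncoord E (lift ord_max i) = ncoord H i.
  apply/ncoordP/ncoordP => [[u [w]]|[x [y [xH yH d]]]].
    have [x [c ->]] := extP u; have [y [d ->]] := extP w.
    by rewrite !in_E !ext_lift => -[/inH xH /inH yH xy]; exists x, y.
  have [c xc] := side_cup xH; have [e ye] := side_cup yH.
  by exists (ext x c), (ext y e); rewrite !in_E !ext_lift.
move=> u; have [x [c ->]] := extP u; rewrite in_E => xc.
suff -> : antipode E (ext x c) = ext (antipode H x) (~~ c) by rewrite in_E side_antipode.
apply/ffunP=> l; rewrite ffunE; case: (unliftP ord_max l) => [i ->|->].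
  by rewrite Nlift !ext_lift ffunE.
by rewrite Nmax !ext_max.
Qed.

(** The maximal proper antipodal subgraphs of the cycle are its edges. Each edge lies on one side,
    and none joins [a] to [b] because these differ in both [k] and [j]. *)
Lemma wedge_gen_pos :
  gen_pos_OM_expansion H (H :\: wedge H k j a b) (H :\: wedge H k j b a).
Proof.
change (gen_pos_OM_expansion H (side true) (side false)).
have inH e z : z \in side e -> z \in H by rewrite in_side => /andP[].
split.
- apply/setP=> x; rewrite inE; apply/orP/idP => [[]/inH //|/side_cup[[]]]; by [left|right].
- by apply/set0Pn; exists a; rewrite inE !side_a.
- split=> //; apply: deg2_COM E_step E_deg2.
  by apply/set0Pn; exists (ext a true); rewrite in_E.
have edge w i : w \in H -> flip i w \in H ->
    ([set w; flip i w] \subset side true \/ [set w; flip i w] \subset side false)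
    /\ ~~ ([set w; flip i w] \subset side true :&: side false).
  move=> wW fH; split; last first.
    apply/negP; rewrite subUset !sub1set !in_setI => /andP[/andP[w1 w2] /andP[f1 f2]].
    have [l li ll] : exists2 l, l != i & a l != b l.
      by case: (eqVneq i k) => [->|]; [exists j; rewrite // eq_sym | exists k; rewrite // eq_sym].
    have fl : flip i w l = w l by rewrite flip_ne.
    case: (side_cap w1 w2) => ew; case: (side_cap f1 f2) => ef; move: fl; rewrite ef ew => e.
    + by have := flip_neq i w; rewrite ef ew eqxx.
    + by rewrite e eqxx in ll.
    + by rewrite e eqxx in ll.
    + by have := flip_neq i w; rewrite ef ew eqxx.
  have [c wc] := side_cup wW.
  suff [d] : exists d, [set w; flip i w] \subset side d by case: d; [left|right].
  have [fc|fc] := boolP (flip i w \in side c).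
    by exists c; rewrite subUset !sub1set wc.
  have [wd|wd] := boolP (w \in side (~~ c)); last by rewrite (side_flip wc wd fH) in fc.
  exists (~~ c); rewrite subUset !sub1set wd /=.
  have [e fe] := side_cup fH; have -> // : ~~ c = e.
  by move: fc fe; case: (c); case: (e) => // /negbTE ->.
move=> W [aW WV mW].
have [WH|[w [i EW]]|[w EW]] := deg2_antipodal_sub sH (wc_deg2 wH) aW.
- by rewrite WH eqxx in WV.
- have [WH _ _ _ _] := (antipodal_subE _ sH).1 aW.
  by move: WH; rewrite EW subUset !sub1set => /andP[h1 h2]; apply: edge.
have [WH _ _ _ _] := (antipodal_subE _ sH).1 aW.
(* A single vertex is not maximal: it lies on an edge, and [H] is no edge, since the neighbours of
   [a] are on different sides. *)
have wW : w \in H by apply: (subsetP WH); rewrite EW inE.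
have [i fi] : exists i, flip i w \in H.
  case: (eqVneq w a) => [->|wa]; first by exists k; apply: (wc_ka wH).
  by have [i _ fi] := sH wW (wc_a wH) wa; exists i.
have aE := edge_antipodal_sub sH wW fi.
have EV : [set w; flip i w] != H.
  apply/eqP=> EH; have [] := edge w i wW fi; rewrite EH => -[] /subsetP s _.
    have := s _ (wc_ka wH); rewrite in_side flip_id flip_ne 1?eq_sym //.
    by rewrite (negbTE aj) orbF; case: (a k); rewrite ?andbF.
  have := s _ (wc_ja wH); rewrite in_side flip_id flip_ne //.
  by rewrite (negbTE ak) /=; case: (a j); rewrite ?andbF.
have Ww := mW _ aE EV; rewrite EW sub1set in Ww.
have /setP/(_ (flip i w)) := Ww (set21 _ _).
by rewrite !inE eqxx orbT (negbTE (flip_neq i w)).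
Qed.

End WedgeExpansion.

(** * Corners from wedges, leaves and single vertices *)

Section Corners.
Variable n : nat.
Implicit Types (G H : {set sv n}) (k j : 'I_n).

(** The alternative [C = G] ends the peeling, since the empty set is not a COM. *)
Definition has_corner G : Prop := exists C, [/\ C != set0, corner G C &
  C = G \/ COM (G :\: C)].

(** A vertex of [G] that agrees with a wedge vertex on the classes of [H] agrees on [k] and [j], so
    it is in the wedge and hence in [H]. This gives the fibre condition of [corner_cell]. *)
Lemma wedge_has_corner G H k j a b : COM G -> antipodal_sub G H ->
  wedge_cell H k j a b -> wedge G k j a b \subset H -> has_corner G.
Proof.
move=> cG aH wH FH; have sG := COM_stepwise cG.
have [HG _ _ _ _] := (antipodal_subE _ sG).1 aH.
have E : wedge G k j a b = wedge H k j a b.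
  apply/setP=> x; apply/idP/idP => xF; last first.
    by move: xF; rewrite !inE => /andP[/(subsetP HG)->].
  by have := subsetP FH _ xF; move: xF; rewrite !inE => /andP[_ ->] ->.
have F0 : wedge G k j a b != set0.
  apply/set0Pn; exists (flip k a); rewrite inE (subsetP HG _ (wc_ka wH)) flip_id.
  have := wc_kj wH; rewrite eq_sym => /(flip_ne _)->; rewrite eqxx andbT /=.
  by have := wc_k wH; case: (a k); case: (b k).
exists (wedge G k j a b); split=> //; last by right; apply: COM_setD_wedge cG aH wH FH.
apply: (corner_cell cG aH FH F0) => [c x cF xG xc|].
  have xF : x \in wedge G k j a b.
    move: cF; rewrite !inE xG => /and3P[_ /eqP<- /eqP<-].
    by rewrite !xc ?eqxx //; [apply: wedge_ncoordj wH | apply: wedge_ncoordk wH].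
  apply/ffunP=> i; have [/xc //|nc] := boolP (ncoord H i).
  by apply: (nncoord nc); apply: (subsetP FH).
left; exists (H :\: wedge H k j a b), (H :\: wedge H k j b a).
split; first exact: wedge_gen_pos.
rewrite E setDDr setDv set0U; apply/esym/setIidPr/subsetP=> x.
by rewrite inE => /andP[].
Qed.

Lemma rank_edge (u : sv n) k : rank [set u; flip k u] <= 1.
Proof.
apply/bigmax_leqP=> S /forallP sS; suff /subset_leq_card : S \subset [set k] by rewrite cards1.
apply/subsetP=> i iS; rewrite inE; have /existsP[v /andP[]] := sS [ffun=> ~~ u i].
rewrite !inE => vE /forallP/(_ i); rewrite iS /= ffunE.
by case/orP: vE => /eqP->; rewrite ?ffunE; case: (i == k) => //; case: (u i).
Qed.

(** The pendant edge at [u] is the only maximal antipodal subgraph containing [u], and the remainder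
    is a halfspace, hence convex. *)
Lemma leaf_has_corner G u k : COM G -> u \in G -> flip k u \in G ->
  (forall x, x \in G -> x k = u k -> x = u) -> has_corner G.
Proof.
move=> cG uG fG U; have sG := COM_stepwise cG.
have aH := edge_antipodal_sub sG uG fG.
exists [set u]; split.
- by apply/set0Pn; exists u; rewrite inE.
- apply: (corner_cell cG aH).
  + by rewrite sub1set !inE eqxx.
  + by apply/set0Pn; exists u; rewrite inE.
  + move=> c x; rewrite inE => /eqP-> xG xu; apply: U => //; apply: xu.
    by rewrite edge_ncoord.
  by right; split; [apply: rank_edge | exists u; rewrite ?inE ?eqxx].
right.
have inR x : x \in G :\: [set u] -> x \in G /\ x k = ~~ u k.
  rewrite !inE => /andP[xu xG]; split=> //; have := U x xG.
  by case: (x k) (u k) => [] [] // /(_ erefl) e; rewrite e eqxx in xu.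
have Rin x : x \in G -> x k = ~~ u k -> x \in G :\: [set u].
  by move=> xG xk; rewrite !inE xG andbT; apply/eqP=> e; move: xk; rewrite e; case: (u k).
have sR : stepwise (G :\: [set u]).
  move=> x y /inR[xG xk] /inR[yG yk] xy; have [i xi fi] := sG _ _ xG yG xy.
  exists i => //; apply: Rin => //; rewrite flip_ne //.
  by apply: contraNneq xi => <-; rewrite xk yk.
apply: (COM_subset cG (subsetDl _ _) _ sR).
  by apply/set0Pn; exists (flip k u); apply: Rin => //; rewrite flip_id.
move=> W /(antipodal_subE _ sR) [WR cW _ _ _] x y z xW yW zG B.
have [_ xk] := inR _ (subsetP WR _ xW); have [_ yk] := inR _ (subsetP WR _ yW).
by apply: (cW x y) => //; apply: Rin => //; case: (B k) => ->.
Qed.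

Lemma singleton_has_corner (v : sv n) : COM [set v] -> has_corner [set v].
Proof.
move=> cG; have sG := COM_stepwise cG; exists [set v]; split; last by left.
  by apply/set0Pn; exists v; rewrite inE.
have nc i : ~~ ncoord [set v] i.
  by apply/ncoordP=> -[u [w []]]; rewrite !inE => /eqP-> /eqP->; rewrite eqxx.
apply: (@corner_cell _ _ [set v] _ cG).
- apply/antipodal_subE => //; split=> //; first by apply/set0Pn; exists v; rewrite inE.
  by move=> u; rewrite !inE => /eqP->; apply/eqP/ffunP=> i; rewrite antipode_c.
- by [].
- by apply/set0Pn; exists v; rewrite inE.
- by move=> c x; rewrite !inE => /eqP-> /eqP->.
right; split; last by exists v; rewrite ?inE.
apply/bigmax_leqP=> S /forallP sS; suff -> : S = set0 by rewrite cards0.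
apply/setP=> i; rewrite inE; apply/negP=> iS.
have /existsP[w /andP[]] := sS [ffun=> ~~ v i]; rewrite inE => /eqP-> /forallP/(_ i).
by rewrite iS ffunE /=; case: (v i).
Qed.

End Corners.

(** * Even cycles spanned by nearest parallel edges *)

Record nearest_edges n (G : {set sv n}) (k : 'I_n) (v w : sv n) : Prop := NearestEdges {
  ne_v : v \in G;
  ne_fv : flip k v \in G;
  ne_w : w \in G;
  ne_fw : flip k w \in G;
  ne_k : w k = v k;
  ne_neq : w != v;
  ne_min : forall z, z \in G -> flip k z \in G -> z k = v k -> between v z w ->
    z = v \/ z = w }.

(* The vertices of G in the smallest subcube containing v, w and their k-neighbours. *)
Definition span n (G : {set sv n}) (k : 'I_n) (v w : sv n) : {set sv n} :=
  [set x in G | [forall i, (i != k) ==> (v i == w i) ==> (x i == v i)]].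

Section Cell.
Variable n : nat.
Implicit Types (u v w x y z : sv n) (i j k : 'I_n) (G : {set sv n}).

Lemma nearest_edges_flip G k v w :
  nearest_edges G k v w -> nearest_edges G k (flip k v) (flip k w).
Proof.
case=> vG fv wG fw wk wv min; split; rewrite ?flipK ?flip_id ?wk //.
  by apply: contra wv => /eqP e; rewrite -(flipK k w) e flipK.
move=> z zG fz zk B; have [|||e|e] := min _ fz; rewrite ?flipK //.
- by rewrite flip_id zk negbK.
- move=> i; case: (eqVneq i k) => [->|ik]; first by left; rewrite flip_id zk negbK.
  by have := B i; rewrite !flip_ne.
- by left; rewrite -e flipK.
- by right; rewrite -e flipK.
Qed.

Lemma span_flip G k v w : span G k (flip k v) (flip k w) = span G k v w.
Proof.
apply/setP=> x; rewrite !inE; congr (_ && _); apply: eq_forallb => i.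
by case: (eqVneq i k) => //= ik; rewrite !flip_ne.
Qed.

Lemma in_span G k v w x :
  reflect (x \in G /\ forall i, i != k -> v i = w i -> x i = v i) (x \in span G k v w).
Proof.
rewrite inE; apply: (iffP andP) => -[xG H]; split=> //.
  by move=> i ik e; have /forallP/(_ i) := H; rewrite ik e eqxx => /eqP.
apply/forallP=> i; apply/implyP=> ik; apply/implyP=> /eqP e.
by rewrite (H i ik e).
Qed.

Lemma interval_closed_stepwise G (W : {set sv n}) :
  stepwise G -> W \subset G -> interval_closed G W -> stepwise W.
Proof.
move=> sG WG cW x y xW yW xy.
have [i xi fi] := sG _ _ (subsetP WG _ xW) (subsetP WG _ yW) xy.
exists i => //; apply: (cW x y) => // l; rewrite ffunE; case: eqP => [->|]; last by left.
by right; move: xi; case: (x i); case: (y i).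
Qed.

Lemma span_interval_closed G k v w : interval_closed G (span G k v w).
Proof.
move=> x y z /in_span[xG xE] /in_span[yG yE] zG B; apply/in_span; split=> // i ik e.
by case: (B i) => ->; [apply: xE | apply: yE].
Qed.

Section Fixed.
Variables (G : {set sv n}) (k : 'I_n) (v w : sv n).
Hypotheses (sG : stepwise G) (vw : nearest_edges G k v w).
Let H := span G k v w.

(** A geodesic from [x] to [y] crosses [k] within the span, where only the edges at [v] and [w] are
    available. The two alternatives say that [v], or [w], is between [x] and [y]. *)
Lemma span_cross x y : x \in H -> y \in H -> x k = v k -> y k != v k ->
  (forall i, v i != w i -> x i = v i \/ y i = v i) \/
  (forall i, v i != w i -> x i = w i \/ y i = w i).
Proof.
move=> /in_span[xG xE] /in_span[yG yE] xk yk.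
have [|z [zG fz zk B]] := @crossing _ _ k x y sG xG yG; first by rewrite xk eq_sym.
have [||e|e] := ne_min vw zG fz; first by rewrite zk.
- move=> i; case: (eqVneq i k) => [->|ik]; first by left; rewrite zk.
  case: (eqVneq (v i) (w i)) => e.
    by left; case: (B i) => ->; [apply: xE | apply: yE].
  by move: e; case: (z i); case: (v i); case: (w i); auto.
- by left=> i _; case: (B i); rewrite e => ->; auto.
- by right=> i _; case: (B i); rewrite e => ->; auto.
Qed.

Lemma span_v : v \in H.
Proof. by apply/in_span; split=> //; apply: ne_v vw. Qed.

Lemma span_w : w \in H.
Proof. by apply/in_span; split=> //; apply: ne_w vw. Qed.

Lemma span_fv : flip k v \in H.
Proof. by apply/in_span; split=> [|i ik _]; rewrite ?flip_ne //; apply: ne_fv vw. Qed.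

Lemma span_fw : flip k w \in H.
Proof. by apply/in_span; split=> [|i ik ->]; rewrite ?flip_ne //; apply: ne_fw vw. Qed.

Lemma span_ncoord i : ncoord H i = (i == k) || (v i != w i).
Proof.
apply/ncoordP/idP => [[x [y [/in_span[_ xE] /in_span[_ yE]]]]|].
  apply: contraR; rewrite negb_or negbK => /andP[ik /eqP e].
  by rewrite xE ?yE.
case/orP=> [/eqP->|e]; last by exists v, w; rewrite span_v span_w.
by exists v, (flip k v); rewrite span_v span_fv flip_id; split=> //; case: (v k).
Qed.

Lemma span_step : stepwise H.
Proof.
apply: interval_closed_stepwise sG _ (@span_interval_closed G k v w).
by apply/subsetP=> x; rewrite inE => /andP[].
Qed.

(* Walk from v towards w: the first vertex that stops being disjoint from y
   (as sets of coordinates differing from v) is one step past the complement of y. *)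
Lemma span_antipode_opp y : y \in H -> y k != v k -> antipode H y \in H.
Proof.
move=> yH yk.
suff [x [xH xk xE]] : exists x, [/\ x \in H, x k = v k &
    forall i, v i != w i -> x i = ~~ y i].
  suff -> : antipode H y = x by [].
  apply/ffunP=> i; rewrite ffunE span_ncoord; case: (eqVneq i k) => [->|ik] /=.
    by rewrite xk; move: yk; case: (y k); case: (v k).
  case: (eqVneq (v i) (w i)) => e /=; last by rewrite xE.
  by have [[_ xs] [_ ys]] := (in_span _ _ _ _ _ xH, in_span _ _ _ _ _ yH); rewrite xs ?ys.
suff gen m x : hamming x w <= m -> x \in H -> x k = v k ->
    (forall i, v i != w i -> x i = v i \/ y i = v i) ->
    exists x, [/\ x \in H, x k = v k & forall i, v i != w i -> x i = ~~ y i].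
  by apply: (gen _ v (leqnn _) span_v) => // i _; left.
elim: m x => [|m IH] x le xH xk xy.
  move: le; rewrite leqn0 hamming_eq0 => /eqP xw; exists x; split=> // i e.
  by case: (xy i e) => [|->]; rewrite xw; move: e; case: (v i); case: (w i).
have wH := span_w.
case: (eqVneq x w) => [xw|xw]; first by apply: (IH x) => //; rewrite xw (eqP (_ : hamming w w == 0)) // hamming_eq0.
have [i xi fi] := span_step xH wH xw.
have ik : i != k by apply: contraNneq xi => ->; rewrite xk (ne_k vw).
have ei : v i != w i.
  by apply: contraNneq xi => e; have [_ ->] := in_span _ _ _ _ _ xH; rewrite ?e.
have fk : flip i x k = v k by rewrite flip_ne // eq_sym.
case: (eqVneq (y i) (v i)) => yi.
  apply: (IH _ _ fi fk); first by rewrite -ltnS -(hamming_step xi).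
  move=> l el; case: (eqVneq l i) => [->|li]; first by right.
  by rewrite flip_ne //; apply: xy.
have [h|h] := span_cross fi yH fk yk.
  case: (h i ei) => e; last by rewrite e eqxx in yi.
  by move: xi ei e; rewrite flip_id; case: (x i); case: (v i); case: (w i).
exists x; split=> // l el; case: (eqVneq l i) => [->|li].
  by move: xi ei yi; case: (x i); case: (v i); case: (w i); case: (y i).
have := h l el; rewrite flip_ne //; have := xy l el; move: el.
by case: (v l); case: (w l); case: (x l); case: (y l) => // _ [] // _ [].
Qed.

End Fixed.

Section Fixed2.
Variables (G : {set sv n}) (k : 'I_n) (v w : sv n).
Hypotheses (sG : stepwise G) (vw : nearest_edges G k v w).
Let H := span G k v w.
Let nc := span_ncoord vw.

Lemma span_antipodal : antipodal H.
Proof.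
move=> y yH; have [e|] := eqVneq (y k) (v k); last exact: span_antipode_opp.
have := span_antipode_opp sG (nearest_edges_flip vw) (y := y).
by rewrite span_flip flip_id e; apply=> //; case: (v k).
Qed.

(** This is [span_cross] for [x] and the antipode of [y]. It says that the sets of coordinates
    differing from [v] are nested, so half of the span is a chain from [v] to [w]. *)
Lemma span_chain x y : x \in H -> y \in H -> x k = v k -> y k = v k ->
  (forall i, v i != w i -> x i = v i \/ y i = w i) \/
  (forall i, v i != w i -> x i = w i \/ y i = v i).
Proof.
move=> xH yH xk yk.
have nk : antipode H y k != v k by rewrite ffunE nc eqxx /= yk; case: (v k).
have [h|h] := span_cross sG vw xH (span_antipodal yH) xk nk; [left|right] => i e;
have := h i e; rewrite [antipode _ _ _]ffunE nc e orbT; move: e;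
by case: (x i); case: (v i); case: (w i); case: (y i) => // _ []; auto.
Qed.

Lemma span_flip_antipode i x : x \in H -> flip i x \in H -> flip i (antipode H x) \in H.
Proof.
move=> xH /span_antipodal; suff -> : antipode H (flip i x) = flip i (antipode H x) by [].
by apply/ffunP=> l; rewrite !ffunE; case: (l == i); case: (ncoord H l).
Qed.

(** In a chain, of two neighbours other than the one across [k], one is nearer to [v] and the other
    nearer to [w]. A [k]-edge exists only at the ends [v] and [w], where one of these directions is
    missing. *)
Lemma span_deg2 : deg2 H.
Proof.
suff key x i1 i2 i3 : x \in H -> x k = v k -> flip i1 x \in H -> flip i2 x \in H ->
    flip i3 x \in H -> [|| i1 == i2, i1 == i3 | i2 == i3].
  move=> x i1 i2 i3 xH f1 f2 f3; have [e|e] := eqVneq (x k) (v k); first exact: (key x).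
  apply: (key (antipode H x)); rewrite ?span_antipodal ?span_flip_antipode //.
  by rewrite ffunE nc eqxx /=; move: e; case: (x k); case: (v k).
move=> xH xk.
have D i : i != k -> flip i x \in H -> v i != w i.
  move=> ik fi; have := ncoord_flip xH fi.
  by rewrite nc (negbTE ik).
have two i j : i != j -> i != k -> j != k -> flip i x \in H -> flip j x \in H ->
    (x i == v i) != (x j == v j).
  move=> ij ik jk fi fj; have [di dj] := (D i ik fi, D j jk fj).
  have ji : j != i by rewrite eq_sym.
  have [||h|h] := span_chain fi fj; rewrite ?flip_ne // 1?eq_sym //.
    have := h j dj; have := h i di; move: (di) (dj); rewrite !flip_id !flip_ne //.
    case: (x i); case: (v i); case: (w i); case: (x j); case: (v j); case: (w j) => //;
    by move=> _ _ [] // _ [].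
  have := h j dj; have := h i di; move: (di) (dj); rewrite !flip_id !flip_ne //.
  case: (x i); case: (v i); case: (w i); case: (x j); case: (v j); case: (w j) => //;
  by move=> _ _ [] // _ [].
have twok i j : i != k -> j != k -> flip k x \in H -> flip i x \in H -> flip j x \in H ->
    i = j.
  move=> ik jk fk fi fj; apply/eqP; apply: contraT => ij.
  have := two i j ij ik jk fi fj; have [di dj] := (D i ik fi, D j jk fj).
  have [[xG xE] [fG _]] := (in_span _ _ _ _ _ xH, in_span _ _ _ _ _ fk).
  have [|->|->] := ne_min vw xG fG xk; last 2 first.
  - by rewrite !eqxx.
  - by rewrite ![w _ == _]eq_sym (negbTE di) (negbTE dj).
  move=> l; case: (eqVneq l k) => [->|lk]; first by left.
  case: (eqVneq (v l) (w l)) => e; first by left; apply: xE.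
  by move: e; case: (x l); case: (v l); case: (w l); auto.
move=> f1 f2 f3.
case: (eqVneq i1 i2) => //= n12; case: (eqVneq i1 i3) => //= n13.
apply: contraT => n23.
case: (eqVneq i1 k) => [e1|k1].
  subst i1; have := twok i2 i3; rewrite ![_ == k]eq_sym n12 n13 => /(_ isT isT f1 f2 f3) e.
  by rewrite e eqxx in n23.
case: (eqVneq i2 k) => [e2|k2].
  subst i2; have := twok i1 i3; rewrite [i3 == k]eq_sym k1 n23 => /(_ isT isT f2 f1 f3) e.
  by rewrite e eqxx in n13.
case: (eqVneq i3 k) => [e3|k3].
  subst i3; have := twok i1 i2 k1 k2 f3 f1 f2 => e.
  by rewrite e eqxx in n12.
have := two _ _ n12 k1 k2 f1 f2; have := two _ _ n13 k1 k3 f1 f3.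
have := two _ _ n23 k2 k3 f2 f3.
by case: (x i1 == _); case: (x i2 == _); case: (x i3 == _).
Qed.

Lemma span_antipodal_sub : antipodal_sub G H.
Proof.
apply/antipodal_subE => //; split.
- by apply/subsetP=> x; rewrite inE => /andP[].
- exact: span_interval_closed.
- by apply/set0Pn; exists v; apply: span_v vw.
- exact: span_step sG.
- exact: span_antipodal.
Qed.

(** [flip k v] and [w] are antipodal in the span. The class [j] is that of the chain edge at [w]; by
    antipodality it is also the class of an edge at [flip k v]. *)
Lemma span_wedge_cell : exists2 j, v j != w j & wedge_cell H k j (flip k v) w.
Proof.
have [vH wH] := (span_v vw, span_w vw).
have sH := span_step sG (k := k) (v := v) (w := w).
have [j jw fj] := sH _ _ wH vH (ne_neq vw).
have jk : j != k by apply: contraNneq jw => ->; rewrite (ne_k vw).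
have kj : k != j by rewrite eq_sym.
have ej : v j != w j by rewrite eq_sym.
have top x : x \in H -> x k = v k -> x j = w j -> x = w.
  move=> xH xk xj; apply/ffunP=> i.
  case: (eqVneq i k) => [->|ik]; first by rewrite xk (ne_k vw).
  case: (eqVneq (v i) (w i)) => e; first by have [_ ->] := in_span _ _ _ _ _ xH.
  have [|h|h] := span_chain xH fj xk.
  - by rewrite flip_ne // (ne_k vw).
  - by have := h j ej; rewrite xj flip_id; move: ej; case: (v j); case: (w j) => // _ [].
  case: (eqVneq i j) => [->//|ij]; have := h i e; rewrite flip_ne //.
  by case=> // ew; rewrite ew eqxx in e.
have antw : antipode H w = flip k v.
  apply/ffunP=> i; rewrite !ffunE nc; case: (eqVneq i k) => [->|ik] /=.
    by rewrite (ne_k vw).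
  by case: (v i) (w i) => [] [].
exists j => //; split=> //.
- exact: span_antipodal.
- exact: span_deg2.
- exact: span_fv vw.
- by rewrite flipK.
- by rewrite -antw; apply: span_flip_antipode.
- exact: span_fw vw.
- by rewrite flip_id (ne_k vw); case: (v k).
- by rewrite flip_ne.
- move=> x xH; rewrite flip_id flip_ne // => xk xj.
  have ax : antipode H x = w.
    apply: top; rewrite ?span_antipodal // ffunE nc.
      by rewrite eqxx xk negbK.
    by rewrite ej orbT xj; move: ej; case: (v j); case: (w j).
  rewrite -antw -ax; apply/ffunP=> i; rewrite !ffunE.
  by case: (ncoord H i); rewrite ?negbK.
by move=> x xH; rewrite (ne_k vw); apply: top.
Qed.

End Fixed2.

End Cell.

(** * Free wedges and the descent to a corner *)

Section Existence.
Variable n : nat.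
Implicit Types (u v w x y z : sv n) (i j k s t : 'I_n) (G H Z : {set sv n}).

(** For any two coordinates one of the four quadrants of [Z] is empty, as for the splits of a
    tree. *)
Definition laminar Z : Prop :=
  forall s t, s != t -> exists p q, forall x, x \in Z -> x s = p -> x t <> q.

(** Descent through nested halves: a half with two elements is split by some [t'], and the empty
    quadrant puts one half of [t'] strictly inside it. *)
Lemma laminar_leaf Z t v0 w0 : laminar Z -> v0 \in Z -> w0 \in Z -> v0 t != w0 t ->
  exists v s, [/\ v \in Z, v t = v0 t & forall x, x \in Z -> x s = v s -> x = v].
Proof.
move=> lam; move: {2}#|_| (leqnn #|[set x in Z | x t == v0 t]|) => m.
elim: m t v0 w0 => [|m IH] t v0 w0 le v0Z w0Z vw.
  move: le; rewrite leqn0 cards_eq0 => /eqP/setP/(_ v0).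
  by rewrite !inE v0Z eqxx.
case: (pickP [pred x in Z | (x t == v0 t) && (x != v0)]) => [x /= /and3P[xZ /eqP xt xv]|none].
  have [t' xt'] := neq_coord xv.
  have tt' : t != t' by apply: contraNneq xt' => <-; rewrite xt.
  have [p [q pq]] := lam _ _ tt'.
  (* [v1] is whichever of [x] and [v0] has sign [q] at [t']; the other one, [w1], witnesses that the
     new half is strictly smaller. *)
  have [v1 [w1 [v1Z w1Z v1t w1t [v1q w1q]]]] : exists v1 w1, [/\ v1 \in Z, w1 \in Z,
      v1 t = v0 t, w1 t = v0 t & v1 t' = q /\ w1 t' != q].
    case: (eqVneq (x t') q) => [xq|xq].
      by exists x, v0; split=> //; split=> //; rewrite -xq eq_sym.
    exists v0, x; split=> //; split=> //.
    by move: xt' xq; case: (x t'); case: (v0 t'); case: (q).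
  have pE : p != v0 t by apply/eqP=> e; apply: (pq v1 v1Z) => //; rewrite e.
  have sub x1 : x1 \in Z -> x1 t' = q -> x1 t = v0 t.
    move=> x1Z x1q; have := pq x1 x1Z; move: pE.
    by case: (x1 t); case: (v0 t); case: (p) => // _ /(_ erefl) [].
  have [||v [s [vZ vt vs]]] := IH t' v1 w1 _ v1Z w1Z.
  - rewrite -ltnS; apply: leq_trans le; apply: proper_card; apply/properP; split.
      by apply/subsetP=> x1; rewrite !inE v1q => /andP[x1Z /eqP/(sub _ x1Z)->]; rewrite x1Z eqxx.
    by exists w1; rewrite !inE w1Z ?w1t ?eqxx // v1q (negbTE w1q).
  - by rewrite v1q eq_sym.
  by exists v, s; split=> //; apply: sub => //; rewrite vt.
exists v0, t; split=> // x xZ xt; apply/eqP; apply: contraT => xv.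
by have := none x; rewrite /= xZ xt eqxx xv.
Qed.

Definition edges G k (c : bool) : {set sv n} :=
  [set x in G | (flip k x \in G) && (x k == c)].

Lemma in_edges G k c x :
  reflect [/\ x \in G, flip k x \in G & x k = c] (x \in edges G k c).
Proof. by rewrite inE; apply: (iffP and3P) => -[? ? /eqP]. Qed.

(** If all four quadrants of [s] and [t] contained [k]-edges, the two ends of these edges would
    shatter [s], [t] and [k]. *)
Lemma edges_laminar G k c : (forall S, shattered G S -> #|S| <= 2) ->
  laminar (edges G k c).
Proof.
move=> rG s t st.
have [->|sk] := eqVneq s k.
  by exists (~~ c), true => x /in_edges[_ _ ->]; case: (c).
have [->|tk] := eqVneq t k.
  by exists true, (~~ c) => x /in_edges[_ _ ->]; case: (c).
case E : [exists p, exists q, [forall x in edges G k c, (x s == p) ==> (x t != q)]].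
  move/existsP: E => [p /existsP[q /forall_inP h]]; exists p, q => x xZ xs.
  by have := h x xZ; rewrite xs eqxx => /eqP.
suff /rG : shattered G [set s; t; k].
  by rewrite (setUC [set s; t]) cardsU1 cards2 !inE !negb_or ![k == _]eq_sym sk tk st.
apply/forallP=> f; move/negbT: E; rewrite negb_exists => /forallP/(_ (f s)).
rewrite negb_exists => /forallP/(_ (f t)); rewrite negb_forall => /existsP[x].
rewrite !negb_imply => /and4P[/in_edges[xG fx xk] xs xt _].
have [e|e] := eqVneq (x k) (f k).
  apply/existsP; exists x; rewrite xG; apply/forallP=> i; apply/implyP.
  by rewrite !inE => /orP[/orP[]|] /eqP-> //; rewrite e.
apply/existsP; exists (flip k x); rewrite fx; apply/forallP=> i; apply/implyP.
rewrite !inE => /orP[/orP[]|] /eqP->; rewrite ?flip_id ?flip_ne //.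
by move: e; case: (x k); case: (f k).
Qed.

(** The wedge can be left across [k] only towards [a]. Since [wedge G j k b a] is the same set,
    [free_wedge G j k b a] is freeness of this wedge for [j]. *)
Definition free_wedge G k j (a b : sv n) : Prop :=
  forall x, x \in edges G k (b k) -> x j = a j -> x = flip k a.

Lemma nearest_edges_exists G k v w0 : v \in edges G k (v k) -> w0 \in edges G k (v k) ->
  w0 != v -> exists w, nearest_edges G k v w.
Proof.
move=> vZ w0Z wv0; have /in_edges[vG fv _] := vZ.
pose P := [pred x in edges G k (v k) | x != v].
have P0 : P w0 by rewrite /= w0Z.
case: (arg_minnP (hamming v) P0) => w /= /andP[/in_edges[wG fw wk] wv] min.
exists w; split=> // z zG fz zk /hamming_between B.
case: (eqVneq z v) => [->|zv]; first by left.
right; apply/eqP; rewrite -hamming_eq0 -leqn0 -(leq_add2l (hamming v z)) addn0 B.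
by apply: min; rewrite zv andbT; apply/in_edges.
Qed.

(** Let [v] be an end, isolated among the [k]-edges by [s]. Gating a [k]-edge [x] to the cycle gives
    a [k]-edge of the cycle, at [v] or [w], and [x j = v j] excludes [w]. As [s] separates [v] from
    [w] it is a class of the cycle, so gating preserves it; hence [x s = v s] and [x = v]. *)
Lemma free_wedge_exists G k t v0 w0 : COM G -> (forall S, shattered G S -> #|S| <= 2) ->
  v0 \in edges G k (v0 k) -> w0 \in edges G k (v0 k) -> v0 t != w0 t ->
  exists H v w j, [/\ antipodal_sub G H, wedge_cell H k j (flip k v) w,
    v \in edges G k (v0 k), v t = v0 t &
    forall x, x \in edges G k (v0 k) -> x j = v j -> x = v].
Proof.
move=> cG rG v0Z w0Z vw; have sG := COM_stepwise cG.
have [v [s [vZ vt vs]]] := laminar_leaf (edges_laminar _ _ rG) v0Z w0Z vw.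
have /in_edges[vG fv vk] := vZ.
have wv : w0 != v by apply: contraNneq vw => ->; rewrite vt.
rewrite -vk in vZ w0Z vs *.
have [w vwE] := nearest_edges_exists vZ w0Z wv.
have aH := span_antipodal_sub sG vwE.
have [j vj wH] := span_wedge_cell sG vwE.
exists (span G k v w), v, w, j; split=> // x xZ xj.
have /in_edges[xG fx xk] := xZ.
have gH := cG.2 _ aH; have nc := span_ncoord vwE.
pose g := [ffun i => if ncoord (span G k v w) i then x i else v i].
have gS : g \in span G k v w := gated_gate gH (span_v vwE) xG.
have gfE : flip k g = [ffun i => if ncoord (span G k v w) i then flip k x i else v i].
  apply/ffunP=> i; rewrite !ffunE nc; case: (eqVneq i k) => //= ->.
have gfS : flip k g \in span G k v w by rewrite gfE; apply: gated_gate gH (span_v vwE) fx.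
have [[gG gE] [fgG _]] := (in_span _ _ _ _ _ gS, in_span _ _ _ _ _ gfS).
have gk : g k = v k by rewrite ffunE nc eqxx.
have gv : g = v.
  have [|//|gw] := ne_min vwE gG fgG gk.
    move=> i; case: (eqVneq i k) => [->|ik]; first by left.
    case: (eqVneq (v i) (w i)) => e; first by left; apply: gE.
    by move: e; case: (g i); case: (v i); case: (w i); auto.
  have : g j = v j by rewrite ffunE nc vj orbT.
  by rewrite gw => e; rewrite e eqxx in vj.
have ws : v s != w s.
  apply/eqP=> e; have := ne_neq vwE; rewrite (vs w) ?eqxx //.
  by apply/in_edges; split; [apply: ne_w vwE | apply: ne_fw vwE | apply: ne_k vwE].
by apply: vs => //; rewrite -gv ffunE nc ws orbT.
Qed.

(** A second [j]-edge in the wedge allows [free_wedge_exists] with [j] as the edge class. Separating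
    by [k] from the [j]-edge at [a] keeps the end [v] on the wedge's side of [k]. *)
Lemma free_wedge_or_smaller G H k j a b : COM G ->
  (forall S, shattered G S -> #|S| <= 2) -> antipodal_sub G H ->
  wedge_cell H k j a b -> free_wedge G k j a b ->
  free_wedge G j k b a \/ exists H' j' k' a' b', [/\ antipodal_sub G H',
    wedge_cell H' k' j' a' b', free_wedge G k' j' a' b' &
    wedge G k' j' a' b' \proper wedge G k j a b].
Proof.
move=> cG rG aH wH fr; have sG := COM_stepwise cG.
have [HG _ _ _ _] := (antipodal_subE _ sG).1 aH.
have [[kj ak] aj] := (wc_kj wH, wc_k wH, wc_j wH).
have jk : j != k by rewrite eq_sym.
case: (pickP [pred z in edges G j (a j) | (z k == b k) && (z != flip j b)]); last first.
  move=> none; left=> x xZ xk; apply/eqP; apply: contraT => xb.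
  by have := none x; rewrite /= xZ xk eqxx xb.
move=> z /= /and3P[zZ /eqP zk zb]; right.
have aZ : a \in edges G j (a j).
  by apply/in_edges; rewrite !(subsetP HG) ?(wc_a wH) ?(wc_ja wH).
have fbZ : flip j b \in edges G j (a j).
  apply/in_edges; rewrite flipK !(subsetP HG) ?(wc_b wH) ?(wc_jb wH) // flip_id.
  by split=> //; move: aj; case: (a j); case: (b j).
have zj : z j = a j by case/in_edges: zZ.
have [|||H' [v [w [m [aH' wH' vZ vk fr']]]]] := @free_wedge_exists G j k z a cG rG; rewrite ?zj //.
  by rewrite zk eq_sym.
rewrite zj in vZ fr'; rewrite zk in vk.
have /in_edges[vG fvG vj] := vZ.
have mj : m != j by rewrite eq_sym; apply: wc_kj wH'.
have wj : w j = a j.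
  by have := wc_k wH'; rewrite flip_id vj; case: (w j); case: (a j).
have am : a m != v m.
  by apply: contraNneq ak => e; rewrite (fr' a aZ e) vk.
(* With [m = k], the two [j]-edges [z] and [flip j b] would both coincide with [v]. *)
have mk : m != k.
  apply: contraNneq zb => e; subst m.
  rewrite (fr' z zZ) ?zk ?vk // (fr' _ fbZ) // flip_ne ?vk //.
have notin : flip k a \notin wedge G j m (flip j v) w.
  rewrite inE; apply/negP=> /and3P[_ _].
  by rewrite !flip_ne // (negbTE am).
exists H', m, j, (flip j v), w; split=> //.
  by move=> x; rewrite wj flip_ne // flipK => xZ xm; apply: fr'.
apply/properP; split; last first.
  exists (flip k a) => //; rewrite inE (subsetP HG _ (wc_ka wH)) flip_id flip_ne //.
  by rewrite eqxx andbT /=; move: ak; case: (a k); case: (b k).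
apply/subsetP=> x; rewrite !inE => /and3P[xG /eqP xj /eqP xm].
rewrite xG xj wj eqxx andbT /=; rewrite wj in xj; rewrite flip_ne // in xm.
(* Otherwise some k-edge separates v from x inside the new wedge; but flip k a
   is the only k-edge with j-coordinate a j, and it lies outside. *)
apply: contraT => xk.
have [|y [yG fy yk B]] := @crossing _ _ k v x sG vG xG; first by rewrite vk eq_sym.
have yj : y j = a j by case: (B j) => ->.
have ym : y m = v m by case: (B m) => ->.
have yE : y = flip k a by apply: fr => //; apply/in_edges; rewrite yk vk.
by move: am; rewrite -ym yE flip_ne // eqxx.
Qed.

(** The class [i] of the first step from the gate [g] to a wedge vertex [x] outside [H] does not
    cross [H]. A path leaving the wedge within the halfspace of [x] would use one of the two exits,
    whose ends are in [H]. *)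
Lemma wedge_or_halfspace G H k j a b : COM G -> antipodal_sub G H ->
  wedge_cell H k j a b -> free_wedge G k j a b -> free_wedge G j k b a ->
  wedge G k j a b \subset H \/ exists i (x y : sv n), [/\ x \in G, y \in G, y i != x i &
    [set z in G | z i == x i] \proper wedge G k j a b].
Proof.
move=> cG aH wH fk fj; have sG := COM_stepwise cG.
have [HG _ _ _ _] := (antipodal_subE _ sG).1 aH.
have [[kj ak] aj] := (wc_kj wH, wc_k wH, wc_j wH).
have jk : j != k by rewrite eq_sym.
have [|/subsetPn[x xF xH]] := boolP (wedge G k j a b \subset H); [by left|right].
have := xF; rewrite inE => /and3P[xG /eqP xk /eqP xj].
pose g := [ffun i => if ncoord H i then x i else a i].
have gH : g \in H := gated_gate (cG.2 _ aH) (wc_a wH) xG.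
have gk : g k = b k by rewrite ffunE (wedge_ncoordk wH).
have gj : g j = a j by rewrite ffunE (wedge_ncoordj wH).
have gx : g != x by apply: contraNneq xH => <-.
have [i gi fi] := sG _ _ (subsetP HG _ gH) xG gx.
have ni : ~~ ncoord H i by move: gi; rewrite ffunE; case: (ncoord H i); rewrite ?eqxx.
have ki : k != i by apply: contraNneq ni => <-; apply: wedge_ncoordk wH.
have ji : j != i by apply: contraNneq ni => <-; apply: wedge_ncoordj wH.
have ci h : h \in H -> h i != x i.
  by move=> hH; rewrite (nncoord ni hH gH).
have avoid z : z \in G -> flip k z \in G -> z k = b k -> z j = a j -> z i != x i.
  by move=> zG fz zk zj; rewrite (fk z) ?ci ?(wc_ka wH) //; apply/in_edges.
have avoid' z : z \in G -> flip j z \in G -> z k = b k -> z j = a j -> z i != x i.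
  by move=> zG fz zk zj; rewrite (fj z) ?ci ?(wc_jb wH) //; apply/in_edges.
exists i, x, g; split=> //; first exact: (subsetP HG).
apply/properP; split; last first.
  by exists g; rewrite !inE (subsetP HG _ gH) ?gk ?gj ?eqxx // (negbTE (ci _ gH)).
apply/subsetP=> y; rewrite !inE => /andP[yG /eqP yi]; rewrite yG /=.
have yjP z : z \in G -> z i = x i -> z k = b k -> z j = a j.
  move=> zG zi zk; apply/eqP; apply: contraT => zj.
  have [|t [tG ft tj B]] := @crossing _ _ j x z sG xG zG; first by rewrite xj eq_sym.
  have ti : t i = x i by case: (B i) => ->.
  have tk : t k = b k by case: (B k) => ->.
  by have := avoid' t tG ft tk; rewrite tj xj ti eqxx => /(_ erefl).
case: (eqVneq (y k) (b k)) => yk /=; first by rewrite (yjP y).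
have [|t [tG ft tk B]] := @crossing _ _ k x y sG xG yG; first by rewrite xk eq_sym.
have ti : t i = x i by case: (B i) => ->.
rewrite xk in tk.
by have := avoid t tG ft tk (yjP t tG ti tk); rewrite ti eqxx.
Qed.

(** With two [k]-edges there is a free wedge inside the halfspace. With a single one, at [u], any
    step away from [u] within the halfspace opens a smaller halfspace, which cannot get across [k]
    as it misses [u]. If there is no such step, [u] is a leaf. *)
Lemma halfspace_corner_or_smaller G k x y : COM G ->
  (forall S, shattered G S -> #|S| <= 2) -> x \in G -> y \in G -> y k != x k ->
  [\/ has_corner G,
    exists i (x' y' : sv n), [/\ x' \in G, y' \in G, y' i != x' i &
      [set z in G | z i == x' i] \proper [set z in G | z k == x k]] |
    exists H k' j a b, [/\ antipodal_sub G H, wedge_cell H k' j a b,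
      free_wedge G k' j a b & wedge G k' j a b \proper [set z in G | z k == x k]]].
Proof.
move=> cG rG xG yG yx; have sG := COM_stepwise cG.
have [|u [uG fu uk _]] := @crossing _ _ k x y sG xG yG; first by rewrite eq_sym.
rewrite -uk.
have uZ : u \in edges G k (u k) by apply/in_edges.
case: (pickP [pred w in edges G k (u k) | w != u]) => [w /= /andP[wZ wu]|none].
  have [t tw] := neq_coord wu; rewrite eq_sym in tw.
  have [H [v [w' [j [aH wH vZ _ fr]]]]] := free_wedge_exists cG rG uZ wZ tw.
  have /in_edges[vG fv vk] := vZ.
  have [HG _ _ _ _] := (antipodal_subE _ sG).1 aH.
  have jk : j != k by rewrite eq_sym; apply: wc_kj wH.
  have wk : w' k = u k.
    by have := wc_k wH; rewrite flip_id vk; case: (w' k); case: (u k).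
  apply: Or33; exists H, k, j, (flip k v), w'; split=> //.
    by move=> z; rewrite wk flip_ne // flipK; apply: fr.
  apply/properP; split.
    by apply/subsetP=> z; rewrite !inE wk => /and3P[-> ->].
  exists w'; first by rewrite inE (subsetP HG _ (wc_b wH)) wk eqxx.
  by rewrite inE negb_and; have := wc_j wH; rewrite eq_sym => /negbTE->; rewrite !andbF orbT.
have only z : z \in G -> flip k z \in G -> z k = u k -> z = u.
  move=> zG fz zk; apply/eqP; apply: contraT => zu; have := none z.
  by rewrite /= zu andbT => /negbT/in_edges[].
case: (pickP [pred w in G | (w k == u k) && (w != u)]) => [w /= /and3P[wG /eqP wk wu]|alone].
  rewrite eq_sym in wu; have [i ui fi] := sG _ _ uG wG wu.
  have ki : k != i by apply: contraNneq ui => <-; rewrite wk.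
  apply: Or32; exists i, (flip i u), u; split=> //.
    by rewrite flip_id; case: (u i).
  apply/properP; split; last first.
    by exists u; rewrite !inE uG ?eqxx // flip_id; case: (u i).
  apply/subsetP=> z; rewrite !inE flip_id => /andP[zG /eqP zi]; rewrite zG /=.
  apply: contraT => zk.
  have [|t [tG ft tk B]] := @crossing _ _ k (flip i u) z sG fi zG.
    by rewrite flip_ne // eq_sym.
  rewrite flip_ne // in tk.
  have := B i; rewrite (only t tG ft tk) zi flip_id; case=> e; by move: e; case: (u i).
apply: Or31; apply: (leaf_has_corner cG uG fu) => z zG zk.
apply/eqP; apply: contraT => zu; have := alone z.
by rewrite /= zG zk eqxx zu.
Qed.

Lemma rank2_has_corner G : COM G -> (forall S, shattered G S -> #|S| <= 2) ->
  has_corner G.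
Proof.
move=> cG rG; have sG := COM_stepwise cG.
have [/set0Pn[x xG] _] := cG.1.
(* One size bound for both statements, as halfspaces and wedges shrink to each other. *)
suff main m :
  (forall k x y, x \in G -> y \in G -> y k != x k ->
     #|[set z in G | z k == x k]| < m -> has_corner G) /\
  (forall H k j a b, antipodal_sub G H -> wedge_cell H k j a b ->
     free_wedge G k j a b -> #|wedge G k j a b| < m -> has_corner G).
  case: (pickP [pred y in G | y != x]) => [y /= /andP[yG yx]|none].
    by have [k yk] := neq_coord yx; apply: ((main _).1 k x y xG yG yk (ltnSn _)).
  have E : G = [set x].
    apply/setP=> y; rewrite inE; apply/idP/eqP => [yG|->//].
    by apply/eqP; apply: contraT => yx; have := none y; rewrite /= yG yx.
  by rewrite E; apply: singleton_has_corner; rewrite -E.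
elim: m => [|m [IHh IHw]]; first by split.
split=> [k x1 y x1G yG yx lt|H k j a b aH wH fr lt].
  have [//|[i [x' [y' [h1 h2 h3 h4]]]]|[H [k' [j [a [b [h1 h2 h3 h4]]]]]]] :=
    halfspace_corner_or_smaller cG rG x1G yG yx.
    by apply: (IHh i x' y') => //; apply: leq_trans (proper_card h4) _.
  by apply: (IHw _ _ _ _ _ h1 h2 h3); apply: leq_trans (proper_card h4) _.
have [fr'|[H' [j' [k' [a' [b' [h1 h2 h3 h4]]]]]]] := free_wedge_or_smaller cG rG aH wH fr.
  have [FH|[i [x' [y' [h1 h2 h3 h4]]]]] := wedge_or_halfspace cG aH wH fr fr'.
    exact: wedge_has_corner cG aH wH FH.
  by apply: (IHh i x' y') => //; apply: leq_trans (proper_card h4) _.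
by apply: (IHw _ _ _ _ _ h1 h2 h3); apply: leq_trans (proper_card h4) _.
Qed.

End Existence.

(** * Peeling off corners one by one *)

Lemma corner_subset n (G C : {set sv n}) : corner G C -> C \subset G.
Proof. by case=> H [[[[HG _] _ _] _] CH _ _]; apply: subset_trans CH HG. Qed.

Lemma corner_peeling_cons n (G C : {set sv n}) Cs :
  C != set0 -> COM G -> corner G C -> corner_peeling (G :\: C) Cs ->
  corner_peeling G (C :: Cs).
Proof.
move=> C0 cG oC [all0 dis cov peel].
have CG := corner_subset oC.
have sub i : i < size Cs -> nth set0 Cs i \subset G :\: C.
  by move=> lt; rewrite -cov (big_nth set0) big_mkord (bigcup_sup (Ordinal lt)).
split.
- by rewrite /= C0.
- case=> [|i] [|j] //= lt; last exact: dis.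
  have := sub j lt; rewrite subsetD => /andP[_].
  by rewrite disjoint_sym.
- rewrite big_cons cov; apply/setP=> x; rewrite !inE.
  by case: (boolP (x \in C)) => //= /(subsetP CG).
case=> [|i] lt /=; first by rewrite big_ord0 setD0.
by rewrite big_ord_recl /= -setDDl; apply: peel.
Qed.

(** The rank may drop during the peeling, so the induction carries the upper bound on shattered
    sets, which passes to subsets. *)
Lemma has_corner_peeling n (G : {set sv n}) :
  COM G -> (forall S, shattered G S -> #|S| <= 2) -> exists Cs, corner_peeling G Cs.
Proof.
move: {2}#|G| (leqnn #|G|) => m; elim: m G => [|m IH] G le cG rG.
  by have := cG.1.1; rewrite -cards_eq0 -leqn0 le.
have [C [C0 oC [E|cR]]] := rank2_has_corner cG rG.
  subst C; exists [:: G]; split; rewrite /= ?C0 //.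
  - by move=> i j /andP[ij]; rewrite ltnS leqn0 => /eqP j0; rewrite j0 in ij.
  - by rewrite big_seq1.
  by case=> //= _; rewrite big_ord0 setD0.
have CG := corner_subset oC.
have [||Cs peel] := IH (G :\: C) _ cR.
- rewrite -ltnS; apply: leq_trans le; apply: proper_card.
  rewrite properEneq subsetDl andbT; apply/eqP=> E; have /set0Pn[c cC] := C0.
  by have := subsetP CG _ cC; rewrite -E inE cC.
- move=> S /forallP sS; apply: rG; apply/forallP=> f.
  have /existsP[v /andP[vR h]] := sS f; apply/existsP; exists v; rewrite h andbT.
  by move: vR; rewrite inE => /andP[].
by exists (C :: Cs); apply: corner_peeling_cons.
Qed.

Theorem mainTheorem12 (n : nat) (G : {set {ffun 'I_n -> bool}}) :
  COM G -> rank G = 2 -> exists Cs : seq {set {ffun 'I_n -> bool}}, corner_peeling G Cs.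
Proof.
move=> cG rG; apply: has_corner_peeling => // S sS.
by rewrite -rG /rank; apply: (@leq_bigmax_cond _ (shattered G) (fun S => #|S|)).
Qed.
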